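(* Let $U$ be a discrete group with torsion, let $e\in\mathbb{C}[U]$ be a nontrivial projection ($e=e^*=e^2$, $e\neq 0,1$), and let $W$ be the inverse of the coefficient of $1$ in the expression of $e$ as a $\mathbb{C}$-linear combination of elements of $U$. Let $T=et+t^{-1}e\in\mathbb{C}[U\wr\mathbb{Z}]$. Then for every $\mu\in\mathbb{R}$, \[ \dim_{U\wr\mathbb{Z}}\ker(T-\mu)=\begin{cases}\dfrac{(W-1)^2}{W^n-1} & \text{if } n\ge 2 \text{ and } \mu\in M_n,\\[2mm] 0 & \text{if } \mu\notin\bigcup_{n\ge 2}M_n.\end{cases} \] Moreover, $l^2(U\wr\mathbb{Z})$ is the Hilbert sum of the eigenspaces of (left multiplication by) $T$, i.e. the spectral measure of $T$ off its eigenspaces is zero.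
   Context: $U\wr\mathbb{Z}=(\bigoplus_{i\in\mathbb{Z}}U)\rtimes C_\infty$, where $C_\infty$ is infinite cyclic with generator $t$ acting by the shift $t^{-1}((g_n)_{n})t=(g_{n-1})_n$; $U$ is identified with the subgroup of elements $(\dots,1,u,1,\dots)$ with $u$ in position $0$. Elements of $\mathbb{C}[U\wr\mathbb{Z}]$ are identified with elements of $l^2(U\wr\mathbb{Z})$ and with operators of left multiplication in the group von Neumann algebra $\mathcal{N}(U\wr\mathbb{Z})$ (bounded operators on $l^2(U\wr\mathbb{Z})$ commuting with right multiplication by group elements). The trace is $\mathrm{tr}_{U\wr\mathbb{Z}}(a)=\langle a(1),1\rangle$. For $\mu\in\mathbb{R}$, $\dim_{U\wr\mathbb{Z}}\ker(T-\mu):=\mathrm{tr}_{U\wr\mathbb{Z}}(\mathrm{pr}_\mu)$, where $\mathrm{pr}_\mu$ is the orthogonal projection of $l^2(U\wr\mathbb{Z})$ onto $\ker(T-\mu)$. For integers $1\le m\le n-1$, $\lambda_{m,n}=2\cos(\frac{m}{n}\pi)$, and for $n\ge 2$, $M_n=\{\lambda_{m,n}\mid 1\le m\le n-1,\ m \text{ coprime to } n\}$. *)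

(* Defs.v *)
(* MathComp + MathComp-Analysis; complex numbers R[i] from mathcomp-real-closed. *)
From HB Require Import structures.
From mathcomp Require Import all_boot all_order all_algebra.
From mathcomp Require Import all_classical all_reals.
From mathcomp Require Import ereal esum trigo.
From mathcomp Require Import complex.

Set Implicit Arguments.
Unset Strict Implicit.
Unset Printing Implicit Defensive.

Import Order.TTheory GRing.Theory Num.Theory.
Local Open Scope classical_set_scope.
Local Open Scope ring_scope.
Local Open Scope complex_scope.

(* Abstract (discrete, possibly infinite) groups.                      *)
Record grp := Grp {
  gcar :> choiceType;
  gmul : gcar -> gcar -> gcar;
  ginv : gcar -> gcar;
  gone : gcar;
  gmulA : forall x y z, gmul x (gmul y z) = gmul (gmul x y) z;
  gmul1x : forall x, gmul gone x = x;
  gmulx1 : forall x, gmul x gone = x;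
  gmulVx : forall x, gmul (ginv x) x = gone;
  gmulxV : forall x, gmul x (ginv x) = gone }.

Arguments gone {g}.

(* n-th power of an element *)
Definition gexp (U : grp) (u : U) (n : nat) : U := iter n (gmul u) gone.

(* U has torsion: a nontrivial element of finite order *)
Definition has_torsion (U : grp) : Prop :=
  exists u : U, u <> gone /\ exists n : nat, (0 < n)%N /\ gexp u n = gone.

Lemma ginv1 (U : grp) : ginv (@gone U) = gone.
Proof. by rewrite -[ginv _]gmulx1 gmulVx. Qed.

(* The wreath product U wr Z = (⊕_{i in Z} U) ⋊ <t>.                    *)
(* An element is  f * t^k  with f : Z -> U finitely supported.          *)
(* Convention of the paper: t^{-1} (g_n)_n t = (g_{n-1})_n, hence       *)
(* t^k (g_n)_n t^{-k} = (g_{n+k})_n, so                                 *)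
(*   (f t^k)(g t^l) = (n |-> f n * g (n+k)) t^{k+l},                    *)
(*   (f t^k)^{-1}   = (n |-> (f (n-k))^{-1}) t^{-k}.                    *)
Section Wreath.
Variable U : grp.

Record wreath := Wreath {
  wfun : int -> U;
  wexp : int;
  wfin : finite_set [set n | wfun n <> gone] }.

HB.instance Definition _ := gen_eqMixin wreath.
HB.instance Definition _ := gen_choiceMixin wreath.

Lemma wmul_fin (x y : wreath) :
  finite_set [set n | gmul (wfun x n) (wfun y (n + wexp x)) <> gone].
Proof.
apply: (@sub_finite_set _ _
  ([set n | wfun x n <> gone] `|` ((fun m => m - wexp x) @` [set m | wfun y m <> gone]))).
  move=> n /= H; case: (pselect (wfun x n = gone)) => [Hx|Hx]; last by left.
  right; exists (n + wexp x); last by rewrite addrK.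
  by move=> Hy; apply: H; rewrite Hx Hy gmul1x.
by rewrite finite_setU; split; [exact: wfin | apply: finite_image; exact: wfin].
Qed.

Definition wmul (x y : wreath) : wreath :=
  @Wreath (fun n => gmul (wfun x n) (wfun y (n + wexp x))) (wexp x + wexp y)
    (wmul_fin x y).

Lemma winv_fin (x : wreath) :
  finite_set [set n | ginv (wfun x (n - wexp x)) <> gone].
Proof.
apply: (@sub_finite_set _ _ ((fun m => m + wexp x) @` [set m | wfun x m <> gone])).
  move=> n /= H; exists (n - wexp x); last by rewrite subrK.
  by move=> Hx; apply: H; rewrite Hx ginv1.
by apply: finite_image; exact: wfin.
Qed.

Definition winv (x : wreath) : wreath :=
  @Wreath (fun n => ginv (wfun x (n - wexp x))) (- wexp x) (winv_fin x).

Lemma wone_fin : finite_set [set n : int | (@gone U) <> gone].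
Proof.
by rewrite (_ : [set n : int | _] = set0) //; apply/seteqP; split => n //=.
Qed.

Definition wone : wreath := @Wreath (fun _ => gone) 0 wone_fin.

(* the generator t *)
Definition wt : wreath := @Wreath (fun _ => gone) 1 wone_fin.

(* U as the subgroup of elements (.., 1, u, 1, ..) with u in position 0 *)
Lemma wemb_fin (u : U) :
  finite_set [set n : int | (if n == 0 then u else gone) <> gone].
Proof.
apply: (@sub_finite_set _ _ [set 0]); last exact: finite_set1.
by move=> n /=; case: eqP.
Qed.

Definition wemb (u : U) : wreath :=
  @Wreath (fun n => if n == 0 then u else gone) 0 (wemb_fin u).

End Wreath.

(* Complex-valued functions on a group: group algebra and l^2.          *)
Section Analysis.
Variable R : realType.
Local Notation C := R[i].

(* support of a function *)
Definition supp (T : choiceType) (a : T -> C) : set T := [set x | a x != 0].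

(* elements of the complex group algebra C[G]: finitely supported functions *)
Definition in_group_algebra (T : choiceType) (a : T -> C) : Prop :=
  finite_set (supp a).

(* Dirac function delta_g *)
Definition dirac_fun (T : choiceType) (g : T) : T -> C :=
  fun x => if `[< x = g >] then 1 else 0.

(* Left convolution  (a * f)(x) = sum_{g in supp a} a g * f (g^{-1} x).
   For a in C[G] this is the product in C[G] when f is in C[G], and the
   operator of left multiplication by a on l^2(G) when f is in l^2(G). *)
Definition conv (T : choiceType) (mul : T -> T -> T) (inv : T -> T)
    (a f : T -> C) : T -> C :=
  fun x => \sum_(g \in supp a) a g * f (mul (inv g) x).

(* the involution a^*(g) = conj (a (g^{-1})) *)
Definition gstar (T : choiceType) (inv : T -> T) (a : T -> C) : T -> C :=
  fun x => (a (inv x))^*.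

(* pushforward of a function along a map (injective in our use) *)
Definition pushf (T T' : choiceType) (phi : T -> T') (a : T -> C) : T' -> C :=
  fun y => \sum_(x \in supp a `&` [set x | phi x = y]) a x.

(* real sum of a (summable) real family indexed by a type T *)
Definition rsum (T : choiceType) (h : T -> R) : R :=
  fine (\esum_(x in [set: T]) (Num.max (h x) 0)%:E) -
  fine (\esum_(x in [set: T]) (Num.max (- h x) 0)%:E).

(* complex sum of a (summable) complex family *)
Definition csum (T : choiceType) (F : T -> C) : C :=
  (rsum (fun x => @complex.Re R (F x)))%:C + 'i * (rsum (fun x => @complex.Im R (F x)))%:C.

(* square-summable functions *)
Definition l2 (T : choiceType) (f : T -> C) : Prop :=
  (\esum_(x in [set: T]) ((@complex.Re R (f x)) ^+ 2 + (@complex.Im R (f x)) ^+ 2)%:E < +oo)%E.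

(* the inner product of l^2(T) *)
Definition inner (T : choiceType) (f g : T -> C) : C :=
  csum (fun x => f x * (g x)^*).

End Analysis.

(* The objects of the theorem.                                          *)
Section Objects.
Variables (R : realType) (U : grp).
Local Notation C := R[i].
Local Notation G := (wreath U).

Definition convU := @conv R U (@gmul U) (@ginv U).
Definition convG := @conv R G (@wmul U) (@winv U).

(* T = e t + t^{-1} e in C[U wr Z], with e viewed in C[U] ⊂ C[U wr Z] *)
Definition Top (e : U -> C) : G -> C :=
  fun x => convG (pushf (@wemb U) e) (@dirac_fun R _ (wt U)) x
         + convG (@dirac_fun R _ (winv (wt U))) (pushf (@wemb U) e) x.

(* ker(T - mu) as a subset of l^2(U wr Z) *)
Definition kerT (e : U -> C) (mu : R) : set (G -> C) :=
  [set f | l2 f /\ forall x, convG (Top e) f x - mu%:C * f x = 0].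

(* dim_{U wr Z} ker(T - mu) = tr(pr_mu) = < pr_mu(delta_1), delta_1 >,
   where pr_mu(delta_1) is the orthogonal projection of delta_1 onto the
   closed subspace ker(T - mu): the unique p in ker(T - mu) with
   delta_1 - p orthogonal to ker(T - mu). *)
Definition has_kernel_dim (e : U -> C) (mu : R) (d : C) : Prop :=
  exists p : G -> C,
    kerT e mu p /\
    (forall q, kerT e mu q ->
       inner (fun x => @dirac_fun R _ (wone U) x - p x) q = 0) /\
    inner p (@dirac_fun R _ (wone U)) = d.

(* M_n = { 2 cos (m pi / n) | 1 <= m <= n-1, m coprime to n } *)
Definition Mset (n : nat) : set R :=
  [set mu | exists m : nat, [/\ (1 <= m)%N, (m <= n.-1)%N, coprime m n &
                             mu = 2 * cos (m%:R / n%:R * pi)]].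

End Objects.

(* Main.v *)
(* Let [E i] be left multiplication by the copy of [e] in position [i]. The [E i]
   are commuting projections, shifted by [t], and [T = E 0 t + t^-1 E 0]. If [v]
   satisfies [E 0 v = 0], [E i v = v] for [0 < i <= m] and [E (m + 1) v = 0], then
   [v, t v, ..., t^m v] is a path on which [T] acts as the adjacency operator, so
   its eigenvalues there are the roots [2 cos (k pi / (m + 2))] of the Chebyshev
   polynomial. Summing over all positions of the path, these vectors exhaust [l^2]:
   what is left of [delta_g] after removing the paths with at most [K] vertices is a
   combination of [2 K + 1] products of at least [K] distinct [E i], each of norm at
   most [alpha^(K/2)], where [alpha = e(1)] lies strictly between 0 and 1. The
   projection onto vectors starting a path with [m + 1] vertices has trace
   [alpha^m (1 - alpha)^2], and a [mu] in [M_N] is an eigenvalue of that path exactly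
   when [N] divides [m + 2]; the geometric series gives the dimension. *)

(* The operators act on all functions on the group, and the scalar product is first used only
   between a finitely supported function and an arbitrary one. Adjoints are then finite identities,
   and limits are needed only for the images of a single Dirac function. Two facts take the place of
   spectral theory. The sum over the paths with at most [K] vertices, each projected to its
   [mu]-eigenvector, is itself an eigenvector of [T]; and paired with any eigenvector it differs
   from [delta_g] only by the remainder on longer paths. As [2 K + 1] loses against [alpha^(K/2)],
   these sums converge to the projection of [delta_g] onto the eigenspace. *)
Require Import Defs.
From HB Require Import structures.
From mathcomp Require Import all_boot all_order all_algebra.
From mathcomp Require Import all_classical all_reals.
From mathcomp Require Import ereal esum trigo.
From mathcomp Require Import complex finmap.
From mathcomp Require Import topology normedtype sequences.
From mathcomp Require Import ring lra zify.
Set Implicit Arguments.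
Unset Strict Implicit.
Unset Printing Implicit Defensive.
Import Order.TTheory GRing.Theory Num.Theory.
Import numFieldNormedType.Exports.
Local Open Scope classical_set_scope.
Local Open Scope ring_scope.
Local Open Scope complex_scope.

(** * Chebyshev polynomials *)

(* [U_n (x / 2)], with [U_n] the Chebyshev polynomial of the second kind: the
   characteristic polynomial of the path with [n] vertices. *)
Fixpoint cheb (F : nzRingType) (x : F) (n : nat) : F :=
  match n with
  | 0 => 1
  | 1 => x
  | (n'.+1 as n1).+1 => x * cheb x n1 - cheb x n'
  end.

Arguments cheb : simpl never.

Lemma chebSS (F : nzRingType) (x : F) n : cheb x n.+2 = x * cheb x n.+1 - cheb x n.
Proof. by []. Qed.

(** Serves for evaluation of polynomials at a point and for the embedding of the reals into
    [R[i]]. *)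
Lemma rmorph_cheb (F F' : nzRingType) (h : {rmorphism F -> F'}) x n :
  h (cheb x n) = cheb (h x) n.
Proof.
suff: h (cheb x n) = cheb (h x) n /\ h (cheb x n.+1) = cheb (h x) n.+1 by case.
elim: n => [|n [IH1 IH2]]; first by rewrite /cheb rmorph1.
by split=> //; rewrite !chebSS rmorphB rmorphM IH1 IH2.
Qed.

Lemma horner_cheb (F : comNzRingType) (x : F) n : (cheb ('X : {poly F}) n).[x] = cheb x n.
Proof. by rewrite -[LHS]/(horner_eval x _) rmorph_cheb /= /horner_eval hornerX. Qed.

Lemma size_cheb (F : idomainType) n : size (cheb ('X : {poly F}) n) = n.+1.
Proof.
suff: size (cheb ('X : {poly F}) n) = n.+1 /\ size (cheb ('X : {poly F}) n.+1) = n.+2 by case.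
elim: n => [|n [IH1 IH2]]; first by rewrite /cheb size_poly1 size_polyX.
split=> //; rewrite chebSS; have nz : cheb ('X : {poly F}) n.+1 != 0 by rewrite -size_poly_eq0 IH2.
by rewrite mulrC size_polyDl size_mulX ?IH2// size_polyN IH1.
Qed.

(** The combination is a polynomial of degree below [n] with [n] roots, hence zero, and the
    [cheb 'X i] have distinct degrees. This says that the eigenvectors of a path span all functions
    on its vertices. *)
Lemma cheb_indep (F : fieldType) (rs : seq F) n (y : nat -> F) :
  uniq rs -> size rs = n ->
  (forall x, x \in rs -> \sum_(i < n) y i * cheb x i = 0) ->
  forall i, (i < n)%N -> y i = 0.
Proof.
move=> urs srs H.
have {rs urs srs H} : \sum_(i < n) (y i)%:P * cheb ('X : {poly F}) i = 0.
  apply: (@roots_geq_poly_eq0 _ _ rs) => //.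
    apply/allP => x xrs; rewrite /root horner_sum; apply/eqP.
    rewrite -[RHS](H x xrs); apply: eq_bigr => i _.
    by rewrite hornerM hornerC horner_cheb.
  rewrite srs; apply/leq_sizeP => j nj; rewrite coef_sum big1// => i _.
  by rewrite coefCM nth_default ?mulr0// size_cheb (leq_trans _ nj).
elim: n => [//|n IH] H.
have yn : y n = 0.
  move/(congr1 (fun p : {poly F} => p`_n)): H; rewrite coef0 coef_sum big_ord_recr/=.
  rewrite big1 ?add0r => [|i _]; last by rewrite coefCM nth_default ?mulr0// size_cheb.
  rewrite coefCM => /eqP; rewrite mulf_eq0 => /orP[/eqP//|].
  have := lead_coef_eq0 (cheb ('X : {poly F}) n); rewrite lead_coefE size_cheb/= => ->.
  by rewrite -size_poly_eq0 size_cheb.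
move=> i; rewrite ltnS leq_eqVlt => /orP[/eqP->//|]; apply: IH.
by move: H; rewrite big_ord_recr/= yn mul0r addr0.
Qed.

(** * Roots of the Chebyshev polynomials and the sets [M_n] *)

Section ChebyshevRoots.
Variable R : realType.
Local Notation lam n m := (2 * cos (m%:R / n%:R * pi) : R).

Lemma sin_cheb (t : R) n : sin t * cheb (2 * cos t) n = sin (n.+1%:R * t).
Proof.
suff: sin t * cheb (2 * cos t) n = sin (n.+1%:R * t) /\
      sin t * cheb (2 * cos t) n.+1 = sin (n.+2%:R * t) by case.
elim: n => [|n [IH1 IH2]].
  by rewrite /cheb mulr1 mul1r !mulr_natl sin_mulr2n; split=> //; ring.
split=> //; rewrite chebSS mulrBr mulrCA IH1 IH2.
have -> : n.+3%:R * t = n.+2%:R * t + t by rewrite -[n.+3]addn1 natrD; ring.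
have -> : n.+1%:R * t = n.+2%:R * t - t by rewrite -[n.+2]addn1 natrD; ring.
by rewrite !sinD sinN cosN; ring.
Qed.

Lemma sin_natpi n : sin (n%:R * pi) = 0 :> R.
Proof.
elim: n => [|n IH]; first by rewrite mul0r sin0.
by rewrite -natr1 mulrDl mul1r sinDpi IH oppr0.
Qed.

Lemma lam_inj a b c d : (0 < b)%N -> (0 < d)%N -> (a <= b)%N -> (c <= d)%N ->
  lam b a = lam d c -> (a * d = c * b)%N.
Proof.
move=> b0 d0 ab cd.
have I u v : (0 < v)%N -> (u <= v)%N -> (u%:R / v%:R * pi : R) \in `[0, pi].
  move=> v0 uv; rewrite in_itv/= mulr_ge0 ?pi_ge0 ?divr_ge0//=.
  by rewrite ler_piMl ?pi_ge0// ler_pdivrMr ?ltr0n// mul1r ler_nat.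
have two : (2 : R) != 0 by rewrite pnatr_eq0.
move/(mulfI two)/(cos_inj (I _ _ b0 ab) (I _ _ d0 cd)).
have pi0 : (pi : R) != 0 by rewrite gt_eqF ?pi_gt0.
move/(mulIf pi0)/eqP; rewrite eqr_div ?pnatr_eq0 -?lt0n// -!natrM eqr_nat.
by move/eqP.
Qed.

Lemma cheb_lam n m : (0 < m <= n)%N -> cheb (lam n.+1 m) n = 0.
Proof.
move=> /andP[m0 mn]; set t : R := _ * pi.
have n0 : (n.+1%:R : R) != 0 by rewrite pnatr_eq0.
have s0 : sin t != 0.
  rewrite gt_eqF// sin_gt0_pi// mulr_gt0 ?pi_gt0 ?divr_gt0 ?ltr0n//=.
  by rewrite gtr_pMl ?pi_gt0// ltr_pdivrMr ?ltr0n// mul1r ltr_nat ltnS.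
by apply: (mulfI s0); rewrite sin_cheb mulr0 /t mulrA mulrCA divff// mulr1 sin_natpi.
Qed.

Definition lams n : seq R := [seq lam n.+1 m | m <- iota 1 n].

Lemma lams_uniq n : uniq (lams n).
Proof.
rewrite map_inj_in_uniq ?iota_uniq// => a b; rewrite !mem_iota => /andP[_ an] /andP[_ bn].
have E m : (m < 1 + n -> m <= n.+1)%N by rewrite add1n => /ltnW.
move/lam_inj => /(_ isT isT (E _ an) (E _ bn)) /eqP.
by rewrite eqn_pmul2r// => /eqP.
Qed.

Lemma size_lams n : size (lams n) = n.
Proof. by rewrite size_map size_iota. Qed.

Lemma cheb_lams n x : x \in lams n -> cheb x n = 0.
Proof.
case/mapP => m; rewrite mem_iota add1n ltnS => mn ->; exact: cheb_lam.
Qed.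

(** The [n] distinct roots in [lams n] exhaust the degree; one more would make the polynomial
    zero. *)
Lemma cheb_root (mu : R) n : cheb mu n = 0 -> exists2 m, (0 < m <= n)%N & mu = lam n.+1 m.
Proof.
move=> H; have [/mapP[m]|nin] := boolP (mu \in lams n).
  by rewrite mem_iota add1n ltnS => mn ->; exists m.
have: cheb ('X : {poly R}) n = 0.
  apply: (@roots_geq_poly_eq0 _ _ (mu :: lams n)).
  - rewrite /= /root horner_cheb H eqxx/=; apply/allP => x /cheb_lams xn.
    by rewrite horner_cheb xn.
  - by rewrite /= nin lams_uniq.
  - by rewrite /= size_lams size_cheb.
by move/eqP; rewrite -size_poly_eq0 size_cheb.
Qed.

(** Since the cosine is injective on [[0, pi]], a root [2 cos (m' pi / (n + 1))] equals
    [2 cos (m pi / N)] only if [m (n + 1) = m' N]; as [m] is coprime to [N], this forces [N] to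
    divide [n + 1]. *)
Lemma cheb_Mset N (mu : R) n : (2 <= N)%N -> Mset N mu ->
  (cheb mu n == 0) = (N %| n.+1)%N.
Proof.
move=> N2 [m [m1 mN cop ->]].
have N0 : (0 < N)%N by apply: ltnW.
have mleN : (m <= N)%N by rewrite (leq_trans mN) ?leq_pred.
apply/eqP/idP => [/cheb_root[m' /andP[_ m'n]]|/dvdnP[k nk]].
  move/lam_inj => /(_ N0 isT mleN (leqW m'n)) E.
  by rewrite -(@Gauss_dvdr _ m) 1?coprime_sym// E dvdn_mull.
have k0 : (0 < k)%N by case: k nk.
have -> : lam N m = lam n.+1 (k * m)%N.
  congr (_ * cos (_ * _)); rewrite nk !natrM invfM mulrACA divff ?mul1r//.
  by rewrite pnatr_eq0 -lt0n.
apply: cheb_lam; rewrite muln_gt0 k0 m1/= -ltnS nk ltn_pmul2l//.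
by rewrite -(prednK N0) ltnS.
Qed.

(** Reducing the fraction [m / (n + 1)] of a root to lowest terms puts the root into some [M_N]. *)
Lemma cheb_nMset (mu : R) n :
  ~ (exists N : nat, (2 <= N)%N /\ Mset N mu) -> cheb mu n != 0.
Proof.
apply: contra_notN => /eqP/cheb_root[m /andP[m0 mn] ->].
set g := gcdn m n.+1; have g0 : (0 < g)%N by rewrite gcdn_gt0 m0.
have [m' Em] := dvdnP (dvdn_gcdl m n.+1); have [N En] := dvdnP (dvdn_gcdr m n.+1).
rewrite -/g in Em En.
have m'0 : (0 < m')%N by move: m0; rewrite Em muln_gt0 => /andP[].
have m'N : (m' < N)%N by rewrite -(ltn_pmul2r g0) -Em -En ltnS.
have N2 : (1 < N)%N by exact: leq_ltn_trans m'0 m'N.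
exists N; split=> //; exists m'; split=> //.
- by rewrite -ltnS prednK// (ltn_trans _ N2).
- by rewrite /coprime -(eqn_pmul2r g0) muln_gcdl -Em -En mul1n.
- rewrite En Em !natrM invfM mulrACA divff ?mulr1//.
  by rewrite pnatr_eq0 -lt0n.
Qed.

End ChebyshevRoots.

(** * Path decomposition *)

Section PathModel.
Variables (F : comNzRingType) (V : lmodType F).
Variables (E : int -> {linear V -> V}) (t t' : {linear V -> V}).
Hypotheses (tK : cancel t t') (t'K : cancel t' t).
Hypothesis EE : forall i v, E i (E i v) = E i v.
Hypothesis EC : forall i j v, E i (E j v) = E j (E i v).
Hypothesis Et : forall i v, E i (t v) = t (E (i + 1) v).

Fixpoint run (s : int) (l : nat) (v : V) : V :=
  if l is l'.+1 then E s (run (s + 1) l' v) else v.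

Lemma run_linear s l : linear (run s l).
Proof. by elim: l s => [//|l IH] s c u v /=; rewrite IH linearP. Qed.

HB.instance Definition _ s l :=
  GRing.isLinear.Build F V V *:%R (run s l) (run_linear s l).

Lemma runE j s l v : E j (run s l v) = run s l (E j v).
Proof. by elim: l s => [//|l IH] s /=; rewrite EC IH. Qed.

Lemma run_run s l v : run s l (run s l v) = run s l v.
Proof. by elim: l s v => [//|l IH] s v /=; rewrite -runE EE IH. Qed.

Lemma run_in s l k v : (k < l)%N -> E (s + k%:Z) (run s l v) = run s l v.
Proof.
elim: l s k => [//|l IH] s [_|k kl] /=; first by rewrite addr0 EE.
by rewrite EC -[k.+1]add1n PoszD addrA IH.
Qed.

Lemma run_last s l v : E (s + l%:Z) (run s l v) = run s l.+1 v.
Proof.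
elim: l s => [|l IH] s; first by rewrite /= addr0.
rewrite -[LHS]/(E (s + l.+1%:Z) (E s (run (s + 1) l v))) EC -[l.+1]add1n PoszD addrA IH.
by rewrite add1n.
Qed.

Lemma run_t s l v : run s l (t v) = t (run (s + 1) l v).
Proof. by elim: l s => [//|l IH] s /=; rewrite IH Et. Qed.

(* The projection onto the vectors for which [E (s + k) = 1] exactly for
   [0 < k <= m] among [0 <= k <= m + 1]. *)
Definition block (s : int) (m : nat) (v : V) : V :=
  run (s + 1) m v - run s m.+1 v - run (s + 1) m.+1 v + run s m.+2 v.

Lemma block_linear s m : linear (block s m).
Proof.
move=> c u v; rewrite /block !(run_linear _ _ c u v).
have S (a b a' b' : V) : (c *: a + b) - (c *: a' + b') = c *: (a - a') + (b - b').
  by rewrite scalerBr opprD addrACA.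
by rewrite !S addrACA -scalerDr.
Qed.

HB.instance Definition _ s m :=
  GRing.isLinear.Build F V V *:%R (block s m) (block_linear s m).

Lemma blockE j s m v : E j (block s m v) = block s m (E j v).
Proof. by rewrite /block linearD !linearB !runE. Qed.

(** [block s m] is the expansion of [(1 - E s) (1 - E (s + m + 1)) run (s + 1) m], so both end
    projections kill it and the ones in between fix it. *)
Lemma block_left s m v : E s (block s m v) = 0.
Proof.
have R1 l : E s (run (s + 1) l v) = run s l.+1 v by [].
have R2 l : E s (run s l.+1 v) = run s l.+1 v by rewrite /= EE.
by rewrite /block linearD !linearB !R1 !R2 subrr sub0r addNr.
Qed.

Lemma block_right s m v : E (s + m.+1%:Z) (block s m v) = 0.
Proof.
have e : s + m.+1%:Z = s + 1 + m%:Z by rewrite -[m.+1]add1n PoszD addrA.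
have R1 : E (s + m.+1%:Z) (run (s + 1) m v) = run (s + 1) m.+1 v by rewrite e run_last.
have R2 : E (s + m.+1%:Z) (run (s + 1) m.+1 v) = run (s + 1) m.+1 v by rewrite e run_in.
have R3 : E (s + m.+1%:Z) (run s m.+2 v) = run s m.+2 v by rewrite run_in.
by rewrite /block linearD !linearB R1 R2 R3 run_last addrAC subrK subrr.
Qed.

Lemma block_mid s m k v : (0 < k <= m)%N -> E (s + k%:Z) (block s m v) = block s m v.
Proof.
case: k => [//|k] /andP[_ km]; rewrite /block linearD !linearB.
have E1 l w : (k < l)%N -> E (s + k.+1%:Z) (run (s + 1) l w) = run (s + 1) l w.
  by move=> kl; rewrite -add1n PoszD addrA run_in.
by rewrite !E1 ?(leqW km)// !run_in ?ltnS// (ltnW km).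
Qed.

Lemma iter_tK n v : iter n t (iter n t' v) = v.
Proof. by elim: n v => [//|n IH] v; rewrite iterSr /= t'K IH. Qed.

Lemma Et' i v : t' (E i v) = E (i + 1) (t' v).
Proof. by rewrite -{1}(t'K v) Et tK. Qed.

Lemma E_iter i n v : E i (iter n t v) = iter n t (E (i + n%:Z) v).
Proof.
elim: n i => [|n IH] i; first by rewrite addr0.
by rewrite /= Et IH -addrA -PoszD add1n.
Qed.

Lemma iter_E' i n v : iter n t' (E i v) = E (i + n%:Z) (iter n t' v).
Proof.
elim: n v => [|n IH] v; first by rewrite addr0.
by rewrite /= IH Et' -addrA -PoszD addn1.
Qed.

(** Hence [block (- b) m] cuts out the vectors that sit on vertex [b], counted from 0, of a path
    with [m + 1] vertices. *)
Lemma block_conj b m v : iter b t (block 0 m (iter b t' v)) = block (- b%:Z) m v.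
Proof.
have S s l w : iter b t (run s l w) = run (s - b%:Z) l (iter b t w).
  elim: b w => [|b IH] w; first by rewrite subr0.
  rewrite /= IH run_t; congr (t (run _ _ _)).
  by rewrite -addn1 PoszD; lia.
have L : linear (iter b t).
  by elim: b {S} => [//|b IH] c x y /=; rewrite IH linearP.
pose f := GRing.isLinear.Build F V V *:%R (iter b t) L.
pose g : {linear V -> V} := HB.pack (iter b t) f.
rewrite -[iter b t (block _ _ _)]/(g (block 0 m (iter b t' v))) /block linearD !linearB.
have G s l : g (run s l (iter b t' v)) = run (s - b%:Z) l v by rewrite -[LHS]/(iter b t _) S iter_tK.
by rewrite !G !sub0r [0 + 1 - _]addrAC sub0r.
Qed.

Definition step v := E 0 (t v) + t' (E 0 v).

Lemma step_linear : linear step.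
Proof. by move=> c u v; rewrite /step !linearP scalerDr addrACA. Qed.

HB.instance Definition _ := GRing.isLinear.Build F V V *:%R step step_linear.

(* [block 0 m v, t (block 0 m v), ...] spans a path with [m + 1] vertices on
   which [step] acts as the adjacency operator. *)
Lemma step_eigen mu m v : cheb mu m.+1 = 0 ->
  step (\sum_(i < m.+1) cheb mu i *: iter i t (block 0 m v)) =
  mu *: \sum_(i < m.+1) cheb mu i *: iter i t (block 0 m v).
Proof.
move=> root; set y := block 0 m v.
have up i : (i < m)%N -> E 0 (t (iter i t y)) = iter i.+1 t y.
  by move=> im; rewrite -iterS E_iter block_mid.
have down i : (i < m)%N -> t' (E 0 (iter i.+1 t y)) = iter i t y.
  by move=> im; rewrite E_iter block_mid//= tK.
have first : t' (E 0 y) = 0 by rewrite block_left linear0.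
have last : E 0 (t (iter m t y)) = 0.
  rewrite -iterS E_iter block_right; elim: m.+1 => //= n ->; exact: linear0.
(* The three-term recurrence summed over the vertices, valid for every [mu]; for [n = m] the
   boundary term carries [cheb mu m.+1], which vanishes at a root. *)
have K n : \sum_(i < n) (cheb mu i *: iter i.+1 t y + cheb mu i.+1 *: iter i t y)
    + cheb mu n.+1 *: iter n t y = mu *: \sum_(i < n.+1) cheb mu i *: iter i t y.
  elim: n => [|n IH]; first by rewrite big_ord0 add0r big_ord1 scale1r.
  rewrite [in RHS]big_ord_recr [in LHS]big_ord_recr scalerDr -IH -!addrA; congr (_ + _).
  by rewrite addrCA -scalerDl chebSS [cheb mu n + _]addrC subrK scalerA.
rewrite -K root scale0r addr0 linear_sum/=.
have stepZ c x : step (c *: x) = c *: E 0 (t x) + c *: t' (E 0 x) by rewrite /step !linearZ.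
under eq_bigr do rewrite stepZ.
rewrite !big_split; congr (_ + _).
  rewrite big_ord_recr/= last scaler0 addr0; apply: eq_bigr => i _.
  by rewrite up.
rewrite big_ord_recl/= first scaler0 add0r; apply: eq_bigr => i _.
by rewrite (down i (ltn_ord i)).
Qed.

(** The vectors [w i] are the components of [v] on the vertices of the path, brought back to vertex
    0. The eigenvalue equation becomes [mu w_i = w_(i-1) + w_(i+1)], with zero beyond both ends
    because the end projections kill the block. The left end yields the Chebyshev recurrence, the
    right end the second claim: no component survives unless [mu] is an eigenvalue of the path. *)
Lemma block_eigen mu m v : step v = mu *: v ->
  (forall i, (i <= m)%N -> block 0 m (iter i t' v) = cheb mu i *: block 0 m v) /\
  cheb mu m.+1 *: block 0 m v = 0.
Proof.
move=> ev; set w := fun i => block 0 m (iter i t' v).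
have rec i : (i <= m)%N ->
    mu *: w i = (if i is j.+1 then w j else 0) + (if (i < m)%N then w i.+1 else 0).
  move=> im; rewrite /w.
  have L : linear (iter i t').
    by elim: i {im} => [//|b IH] c x y /=; rewrite IH linearP.
  pose f := GRing.isLinear.Build F V V *:%R (iter i t') L.
  pose g : {linear V -> V} := HB.pack (iter i t') f.
  rewrite -linearZ/= -[mu *: iter i t' v]/(mu *: g v) -linearZ -ev /step linearD /= linearD/=.
  congr (_ + _).
    case: i im {L f g} => [_|i im]; first by rewrite -blockE block_left.
    by rewrite iter_E' -blockE add0r -[i.+1%:Z]add0r block_mid// iterSr tK.
  rewrite -iterSr -iterS iter_E' -blockE.
  case: ltnP => mi; first by rewrite block_mid.
  by have -> : i = m by [apply/eqP; rewrite eqn_leq im]; rewrite block_right.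
have chebw i : (i <= m)%N -> w i = cheb mu i *: w 0%N /\
    ((i < m)%N -> w i.+1 = cheb mu i.+1 *: w 0%N).
  elim: i => [|i IH] im.
    by rewrite scale1r; split=> // m0; have := rec 0%N im; rewrite m0 add0r.
  have [wi wi1] := IH (ltnW im); split=> [|im1]; first exact: wi1.
  have := rec _ im; rewrite im1 wi (wi1 im) => e; apply: (addrI (cheb mu i *: w 0%N)).
  by rewrite -e chebSS scalerBl scalerA [RHS]addrC subrK.
split=> [i im|]; first by have [] := chebw _ im.
have last (u : nat -> V) k : (forall i, (i <= k)%N -> u i = cheb mu i *: u 0%N) ->
    cheb mu k.+1 *: u 0%N = mu *: u k - (if k is j.+1 then u j else 0).
  case: k => [|k] uE; first by rewrite subr0.
  by rewrite (uE k (leqnSn k)) (uE k.+1 (leqnn _)) chebSS scalerBl scalerA.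
rewrite -[block 0 m v]/(w 0%N) last => [|i im]; last by have [] := chebw _ im.
by rewrite rec// ltnn addr0 subrr.
Qed.

(** Think of a joint eigenvector of the [E i] with [n] consecutive ones across positions 0 and 1.
    For [K > 0] the first sum on the right runs over the windows of length [K] that meet these two
    positions, the second over the windows of length [K + 1] that contain both. If [n >= K], the
    all-one windows of the first kind exceed those of the second by exactly one; otherwise there are
    none of either. So the bracket keeps the paths with more than [K] vertices, and the induction on
    [K] telescopes. *)
Lemma sum_blocks K v : \sum_(m < K) \sum_(b < m.+1) block (- b%:Z) m v =
  v - (\sum_(b < K.+1) run (1 - b%:Z) K v - \sum_(b < K) run (- b%:Z) K.+1 v).
Proof.
elim: K => [|K IH]; first by rewrite !big_ord0 big_ord1 subr0 subrr.
rewrite big_ord_recr/= IH.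
have -> : \sum_(b < K.+1) block (- b%:Z) K v =
    \sum_(b < K.+1) run (1 - b%:Z) K v + \sum_(b < K.+1) run (- b%:Z) K.+2 v
    - (\sum_(b < K.+1) run (- b%:Z) K.+1 v + \sum_(b < K.+1) run (1 - b%:Z) K.+1 v).
  rewrite -!big_split -sumrB; apply: eq_bigr => b _.
  by rewrite /block [- b%:Z + 1]addrC opprD [RHS]addrAC !addrA.
set I := \sum_(b < K.+1) run (1 - b%:Z) K v; set J := \sum_(b < K) _.
set J' := \sum_(b < K.+1) run (- b%:Z) K.+2 v.
set y := run (- K%:Z) K.+1 v; set I' := \sum_(b < K.+1) run (1 - b%:Z) K.+1 v.
have -> : \sum_(b < K.+2) run (1 - b%:Z) K.+1 v = I' + y.
  rewrite big_ord_recr; congr (_ + run _ _ _).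
  by rewrite /=; lia.
have -> : \sum_(b < K.+1) run (- b%:Z) K.+1 v = J + y by rewrite big_ord_recr.
rewrite !opprB -addrA; congr (_ + _); rewrite addrA (addrA (J - I)) subrK.
by rewrite -[J + y + I']addrA opprD addrACA subrr add0r [y + I']addrC.
Qed.

End PathModel.

(** * Convolution operators on a group *)

Section GroupFunctions.
Variables (R : realType) (G : grp).
Local Notation C := R[i].
Implicit Types (a b q f : G -> C) (g x y : G).

Lemma ginvM x y : ginv (gmul x y) = gmul (ginv y) (ginv x).
Proof.
have e : gmul (gmul x y) (gmul (ginv y) (ginv x)) = gone.
  by rewrite gmulA -(gmulA x) gmulxV gmulx1 gmulxV.
by rewrite -[LHS]gmulx1 -e gmulA gmulVx gmul1x.
Qed.

Lemma ginvK : involutive (@ginv G).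
Proof. by move=> x; rewrite -[LHS]gmulx1 -(gmulVx x) gmulA gmulVx gmul1x. Qed.

Lemma gmul_bij g : bijective (gmul g).
Proof.
by exists (gmul (ginv g)) => x; rewrite gmulA ?gmulVx ?gmulxV gmul1x.
Qed.

Definition ltr g f : G -> C := fun x => f (gmul (ginv g) x).

Lemma ltr_linear g : linear (ltr g).
Proof. by []. Qed.

HB.instance Definition _ g :=
  GRing.isLinear.Build C (G -> C) (G -> C) *:%R (ltr g) (ltr_linear g).

Lemma ltrM g h f : ltr (gmul g h) f = ltr g (ltr h f).
Proof. by rewrite /ltr; apply/funext => x; rewrite ginvM gmulA. Qed.

Lemma ltr1 f : ltr gone f = f.
Proof. by rewrite /ltr ginv1; apply/funext => x; rewrite gmul1x. Qed.

Lemma ltrVK g : cancel (ltr g) (ltr (ginv g)).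
Proof. by move=> f; rewrite -ltrM gmulVx ltr1. Qed.

Lemma ltrKV g : cancel (ltr (ginv g)) (ltr g).
Proof. by move=> f; rewrite -ltrM gmulxV ltr1. Qed.

Local Notation fin a := (@in_group_algebra R G a).

Lemma fin_dirac g : fin (dirac_fun R g).
Proof.
apply: (@sub_finite_set _ _ [set g]) (finite_set1 g) => x /=.
by rewrite /supp/= /dirac_fun; case: asboolP => [->//|_]; rewrite eqxx.
Qed.

Lemma finD a b : fin a -> fin b -> fin (a + b).
Proof.
move=> fa fb; apply: (@sub_finite_set _ _ (supp a `|` supp b)); last by rewrite finite_setU.
move=> x; rewrite /supp /= fctE.
have [->|a0 _] := eqVneq (a x) 0; last by left.
by rewrite add0r => ?; right.
Qed.

Lemma finZ (c : C) a : fin a -> fin (c *: a).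
Proof.
apply: sub_finite_set => x; rewrite /supp/= fctE; apply: contra_neq => ->.
exact: scaler0.
Qed.

Lemma fin_sum I (r : seq I) (A : I -> G -> C) :
  (forall i, fin (A i)) -> fin (\sum_(i <- r) A i).
Proof.
move=> fA; elim: r => [|i r IH]; last by rewrite big_cons; exact: finD.
rewrite big_nil; apply: (@sub_finite_set _ _ set0) => // x.
by rewrite /supp/= eqxx.
Qed.

Lemma finB a b : fin a -> fin b -> fin (a - b).
Proof. by move=> fa fb; rewrite -scaleN1r; apply/finD/finZ. Qed.

Lemma fin_ltr g a : fin a -> fin (ltr g a).
Proof.
move=> fa; apply: (@sub_finite_set _ _ (gmul g @` supp a)); last exact: finite_image.
by move=> x xs; exists (gmul (ginv g) x) => //; rewrite gmulA gmulxV gmul1x.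
Qed.

(** The sum runs over the nonzero terms and is 0 by convention if they are infinitely many; for
    finitely supported [a] it is the scalar product with any function [q], square-summable or
    not. *)
Definition pair a q : C := \sum_(x \in [set: G]) a x * conjc (q x).

Lemma pairE (D : {fset G}) a q : (forall x, a x != 0 -> x \in D) ->
  pair a q = \sum_(x <- D) a x * conjc (q x).
Proof.
move=> aD; rewrite /pair (@fsbigTE _ _ _ _ D)// => x; apply: contraNeq => /eqP h.
by apply: aD; apply/eqP => a0; apply: h; rewrite a0 mul0r.
Qed.

Lemma fin_support a b : fin a -> fin b ->
  exists D : {fset G}, (forall x, a x != 0 -> x \in D) /\ (forall x, b x != 0 -> x \in D).
Proof.
move=> fa fb; exists (fset_set (supp a `|` supp b)).
by split=> x xs; rewrite in_fset_set ?finite_setU//; apply/mem_set; [left|right].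
Qed.

Lemma pairDl a b q : fin a -> fin b -> pair (a + b) q = pair a q + pair b q.
Proof.
move=> fa fb; have [D [aD bD]] := fin_support fa fb.
rewrite (pairE q aD) (pairE q bD) (@pairE D).
  by rewrite -big_split; apply: eq_bigr => x _; rewrite fctE mulrDl.
move=> x; rewrite fctE; have [->|/aD//] := eqVneq (a x) 0.
by rewrite add0r => /bD.
Qed.

Lemma pairZl c a q : fin a -> pair (c *: a) q = c * pair a q.
Proof.
move=> fa; have [D [aD _]] := fin_support fa fa.
rewrite (pairE q aD) (@pairE D).
  by rewrite mulr_sumr; apply: eq_bigr => x _; rewrite fctE mulrA.
by move=> x xs; apply: aD; apply: contra_neq xs; rewrite fctE => ->; exact: scaler0.
Qed.

Lemma pairBl a b q : fin a -> fin b -> pair (a - b) q = pair a q - pair b q.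
Proof.
by move=> fa fb; rewrite -scaleN1r pairDl ?pairZl ?mulN1r//; exact: finZ.
Qed.

Lemma pair_suml I (r : seq I) (A : I -> G -> C) q : (forall i, fin (A i)) ->
  pair (\sum_(i <- r) A i) q = \sum_(i <- r) pair (A i) q.
Proof.
move=> fA; elim: r => [|i r IH]; last by rewrite !big_cons pairDl ?IH//; exact: fin_sum.
by rewrite !big_nil /pair fsbig1// => x _; exact: mul0r.
Qed.

Lemma pairZr c a q : pair a (c *: q) = conjc c * pair a q.
Proof.
rewrite /pair mulr_fsumr; apply: eq_fsbigr => x _.
by rewrite fctE -[c *: q x]/(c * q x) rmorphM mulrCA.
Qed.

Lemma pairDr a q q' : fin a -> pair a (q + q') = pair a q + pair a q'.
Proof.
move=> fa; have [D [aD _]] := fin_support fa fa.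
rewrite !(pairE _ aD) -big_split; apply: eq_bigr => x _.
by rewrite fctE rmorphD mulrDr.
Qed.

Lemma pair_sumr I (r : seq I) a (Q : I -> G -> C) : fin a ->
  pair a (\sum_(i <- r) Q i) = \sum_(i <- r) pair a (Q i).
Proof.
move=> fa; elim: r => [|i r IH]; last by rewrite !big_cons pairDr ?IH.
rewrite !big_nil /pair fsbig1// => x _.
by rewrite -[(0 : G -> C) x]/(0 : C) conjc0 mulr0.
Qed.

Lemma pair_ltr g a q : pair (ltr g a) q = pair a (ltr (ginv g) q).
Proof.
rewrite /pair (@reindex_fsbigT _ _ _ _ _ (gmul g) _ (gmul_bij g)); apply: eq_fsbigr => x _.
by rewrite /ltr gmulA gmulVx gmul1x ginvK.
Qed.

Lemma pair_dirac g q : pair (dirac_fun R g) q = conjc (q g).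
Proof.
rewrite (@pairE [fset g]%fset); last first.
  move=> x; rewrite /dirac_fun in_fset1; case: asboolP => [->|_]; by rewrite eqxx.
by rewrite big_seq_fset1 /dirac_fun asboolT// mul1r.
Qed.

(** [Top e] is itself defined through convolutions, and its exact support is awkward to compute; any
    expression as a combination of Dirac functions, repetitions allowed, is enough. *)
Lemma conv_comb (r : seq (C * G)) a f x :
  (forall y, a y = \sum_(p <- r) p.1 * dirac_fun R p.2 y) ->
  conv (@gmul G) (@ginv G) a f x = \sum_(p <- r) p.1 * f (gmul (ginv p.2) x).
Proof.
move=> aE; set F := fun g : G => f (gmul (ginv g) x).
have -> : conv (@gmul G) (@ginv G) a f x = pair a (fun g => conjc (F g)).
  rewrite /conv /pair -[RHS](@fsbig_widen _ _ _ _ (supp a))//.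
    by apply: eq_fsbigr => g _; rewrite conjcK.
  by move=> g [_ /negP]; rewrite negbK => /eqP; rewrite /preimage/= => ->; rewrite mul0r.
have -> : a = \sum_(p <- r) p.1 *: dirac_fun R p.2.
  by apply/funext => y; rewrite aE fct_sumE; apply: eq_bigr => p _; rewrite fctE.
rewrite pair_suml => [|p]; last exact/finZ/fin_dirac.
apply: eq_bigr => p _; rewrite pairZl; last exact: fin_dirac.
by rewrite pair_dirac conjcK.
Qed.

(* [A'] is adjoint to [A] for pairings of a finitely supported function with an
   arbitrary one. *)
Definition adj (A A' : (G -> C) -> G -> C) : Prop :=
  forall a q, fin a -> fin (A a) /\ pair (A a) q = pair a (A' q).

Lemma adj_id : adj id id.
Proof. by []. Qed.

Lemma adj_ltr g : adj (ltr g) (ltr (ginv g)).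
Proof. by move=> a q fa; rewrite pair_ltr; split=> //; exact: fin_ltr. Qed.

Lemma adj_comp A A' B B' : adj A A' -> adj B B' -> adj (A \o B) (B' \o A').
Proof.
move=> HA HB a q fa; have [fB e] := HB a (A' q) fa.
by have [fAB e'] := HA _ q fB; split=> //; rewrite /= e'.
Qed.

Lemma adj_iter A A' n : adj A A' -> adj (iter n A) (iter n A').
Proof.
move=> H; elim: n => [|n IH]; first exact: adj_id.
have -> : iter n.+1 A' = iter n A' \o A' by apply/funext => x /=; rewrite -iterSr.
exact: adj_comp.
Qed.

Lemma adj_sum I (r : seq I) (c : I -> C) (A A' : I -> (G -> C) -> G -> C) :
  (forall i, adj (A i) (A' i)) ->
  adj (fun a => \sum_(i <- r) c i *: A i a) (fun q => \sum_(i <- r) conjc (c i) *: A' i q).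
Proof.
move=> H a q fa; have fA i : fin (A i a) by have [] := H i a q fa.
split; first by apply: fin_sum => i; exact: finZ.
rewrite pair_suml => [|i]; last exact: finZ.
rewrite pair_sumr//; apply: eq_bigr => i _; rewrite pairZl// pairZr conjcK.
by have [_ ->] := H i a q fa.
Qed.

End GroupFunctions.

(** * The operator T on the wreath product *)

Section WreathGroup.
Variable U : grp.
Implicit Types x y z : wreath U.

Lemma wreath_eq x y : wfun x =1 wfun y -> wexp x = wexp y -> x = y.
Proof.
case: x y => [f k pf] [g l pg] /= /funext fg kl; subst g l.
by congr Wreath; exact: Prop_irrelevance.
Qed.

Lemma wmulA x y z : wmul x (wmul y z) = wmul (wmul x y) z.
Proof. by apply: wreath_eq => [n|] /=; rewrite ?gmulA !addrA. Qed.

Lemma wmul1x x : wmul (wone U) x = x.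
Proof. by apply: wreath_eq => [n|] /=; rewrite ?gmul1x ?addr0 ?add0r. Qed.

Lemma wmulx1 x : wmul x (wone U) = x.
Proof. by apply: wreath_eq => [n|] /=; rewrite ?gmulx1 ?addr0. Qed.

Lemma wmulVx x : wmul (winv x) x = wone U.
Proof. by apply: wreath_eq => [n|] /=; rewrite ?gmulVx ?addNr. Qed.

Lemma wmulxV x : wmul x (winv x) = wone U.
Proof. by apply: wreath_eq => [n|] /=; rewrite ?addrK ?gmulxV ?subrr. Qed.

Definition wgrp : grp := Grp wmulA wmul1x wmulx1 wmulVx wmulxV.

Lemma emb_fin (i : int) (u : U) :
  finite_set [set n : int | (if n == i then u else gone) <> gone].
Proof.
apply: (@sub_finite_set _ _ [set i]); last exact: finite_set1.
by move=> n /=; case: eqP.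
Qed.

Definition emb (i : int) (u : U) : wgrp :=
  @Wreath U (fun n => if n == i then u else gone) 0 (emb_fin i u).

Lemma wembE u : wemb u = emb 0 u.
Proof. exact: wreath_eq. Qed.

Lemma embM i u v : emb i (gmul u v) = gmul (emb i u) (emb i v).
Proof. by apply: wreath_eq => //= n; rewrite addr0; case: eqP => _; rewrite ?gmulx1. Qed.

Lemma embV i u : emb i (ginv u) = ginv (emb i u).
Proof. by apply: wreath_eq => //= n; rewrite subr0; case: eqP; rewrite ?ginv1. Qed.

Lemma embC i j u v : i != j -> gmul (emb i u) (emb j v) = gmul (emb j v) (emb i u).
Proof.
move=> ij; apply: wreath_eq => //= n; rewrite !addr0.
have [->|_] := eqVneq n i; first by rewrite (negbTE ij) gmulx1 gmul1x.
by rewrite gmulx1 gmul1x.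
Qed.

Definition wt' : wgrp := wt U.

Lemma t_emb i u : gmul wt' (emb (i + 1) u) = gmul (emb i u) wt'.
Proof.
apply: wreath_eq => //= n; rewrite gmul1x gmulx1.
by rewrite (inj_eq (addIr 1)).
Qed.

End WreathGroup.

(** * Left multiplication by the copies of [e], and the traces of their products *)

Section Operators.
Variables (R : realType) (U : grp) (e : U -> R[i]).
Local Notation C := R[i].
Local Notation G := (wgrp U).
Hypothesis fin_e : @in_group_algebra R U e.
Hypothesis star_e : @gstar R U (@ginv U) e = e.
Hypothesis idem_e : forall u, @convU R U e e u = e u.

Local Notation S := (fset_set (supp e)).

Lemma mem_S u : (u \in S) = (e u != 0).
Proof. by rewrite in_fset_set//; apply/idP/idP => [/set_mem|/mem_set]. Qed.

Lemma e_sum y : e y = \sum_(u <- S) e u * dirac_fun R u y.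
Proof.
have [yS|] := boolP (y \in S).
  rewrite (big_fsetD1 y)//= /dirac_fun asboolT// mulr1 big_seq big1 ?addr0// => u.
  by rewrite !inE => /andP[uy _]; rewrite asboolF ?mulr0// => /esym/eqP; rewrite (negbTE uy).
rewrite mem_S negbK => /eqP e0; rewrite e0 big1// => u _.
by rewrite /dirac_fun; case: asboolP => [<-|_]; rewrite ?e0 ?mul0r ?mulr0.
Qed.

Definition Eop (i : int) (f : G -> C) : G -> C := \sum_(u <- S) e u *: ltr (emb i u) f.

Lemma Eop_linear i : linear (Eop i).
Proof.
move=> c f g; rewrite /Eop scaler_sumr -big_split; apply: eq_bigr => u _.
by rewrite ltr_linear scalerDr !scalerA mulrC.
Qed.

HB.instance Definition _ i :=
  GRing.isLinear.Build C (G -> C) (G -> C) *:%R (Eop i) (Eop_linear i).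

Lemma EopE i f x : Eop i f x = \sum_(u <- S) e u * f (gmul (emb i (ginv u)) x).
Proof. by rewrite /Eop fct_sumE; apply: eq_bigr => u _; rewrite fctE /ltr embV. Qed.

(** Reads [f] along a coset of the copy of [U] in position [i] as a function on [U], which transfers
    the identities satisfied by [e] in [C[U]]. *)
Lemma Eop_pair i f x :
  Eop i f x = pair e (fun u => conjc (f (gmul (emb i (ginv u)) x))).
Proof.
rewrite EopE (@pairE _ _ S); last by move=> u; rewrite mem_S.
by apply: eq_bigr => u _; rewrite conjcK.
Qed.

Lemma e_conv : e = \sum_(u <- S) e u *: ltr u e.
Proof.
apply/funext => y; rewrite -[LHS]idem_e.
rewrite /convU (@conv_comb _ _ [seq (e u, u) | u <- S]).
  by rewrite big_map fct_sumE; apply: eq_bigr => u _; rewrite fctE.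
by move=> z; rewrite big_map -e_sum.
Qed.

Lemma EopEop i f : Eop i (Eop i f) = Eop i f.
Proof.
apply/funext => x; rewrite [RHS]Eop_pair e_conv pair_suml => [|u]; last exact/finZ/fin_ltr.
rewrite EopE; apply: eq_bigr => u _; rewrite pairZl; last exact: fin_ltr.
rewrite pair_ltr Eop_pair; congr (_ * pair _ _); apply/funext => v.
by rewrite /ltr ginvM !ginvK embM gmulA.
Qed.

Lemma EopC i j f : Eop i (Eop j f) = Eop j (Eop i f).
Proof.
have [->//|ij] := eqVneq i j.
have X k l : Eop k (Eop l f) =
    \sum_(u <- S) \sum_(v <- S) (e u * e v) *: ltr (gmul (emb k u) (emb l v)) f.
  rewrite {1}/Eop; apply: eq_bigr => u _; rewrite /Eop linear_sum scaler_sumr.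
  by apply: eq_bigr => v _; rewrite -scalerA ltrM.
rewrite !X exchange_big; apply: eq_bigr => u _; apply: eq_bigr => v _.
by rewrite mulrC embC.
Qed.

Lemma Eop_t i f : Eop i (ltr (wt' U) f) = ltr (wt' U) (Eop (i + 1) f).
Proof.
rewrite /Eop linear_sum; apply: eq_bigr => u _.
by rewrite -ltrM -t_emb ltrM.
Qed.

Lemma conj_e u : conjc (e u) = e (ginv u).
Proof. by rewrite -{1}star_e /gstar conjcK. Qed.

Lemma ginv_bij (H : grp) : bijective (@ginv H).
Proof. by exists (@ginv H) => x; rewrite ginvK. Qed.

(** Taking the adjoint conjugates [e u] and inverts [u]; since [e] is self-adjoint, the substitution
    of [ginv u] for [u] restores the same sum. *)
Lemma adj_E i : adj (Eop i) (Eop i).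
Proof.
have -> : adj (Eop i) (Eop i) =
    adj (Eop i) (fun q => \sum_(u <- S) conjc (e u) *: ltr (ginv (emb i u)) q).
  congr adj; apply/funext => q; apply/funext => y.
  rewrite Eop_pair /pair fct_sumE.
  rewrite (@reindex_fsbigT _ _ _ _ _ (@ginv U) _ (ginv_bij U)).
  rewrite (@fsbigTE _ _ _ _ S) => [|u]; last first.
    by rewrite mem_S negbK => /eqP u0; rewrite -conj_e u0 conjc0 mul0r.
  by apply: eq_bigr => u _; rewrite fctE conjcK -conj_e /ltr !ginvK.
exact/adj_sum/(fun u => adj_ltr (emb i u)).
Qed.

Lemma conv_Top f x : convG (@Top R U e) f x = step Eop (ltr (wt' U)) (ltr (ginv (wt' U))) f x.
Proof.
have pushE y : pushf (@wemb U) e y = \sum_(u <- S) e u * dirac_fun R (emb 0 u) y.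
  rewrite /pushf fsbig_mkcondr fsbig_finite//; apply: eq_bigr => u _.
  rewrite /dirac_fun -wembE; case: ifPn => [/set_mem/= ->|]; first by rewrite asboolT// mulr1.
  by rewrite notin_setE/= => h; rewrite asboolF ?mulr0// => E; apply: h.
have invM (g h y : G) : gmul (ginv (gmul g h)) y = gmul (ginv h) (gmul (ginv g) y).
  by rewrite ginvM gmulA.
rewrite /convG (@conv_comb R G ([seq (e u, gmul (emb 0 u) (wt' U)) | u <- S] ++
   [seq (e u, gmul (ginv (wt' U)) (emb 0 u)) | u <- S])).
  rewrite big_cat !big_map.
  rewrite -[RHS]/(Eop 0 (ltr (wt' U) f) x + Eop 0 f (gmul (ginv (ginv (wt' U))) x)).
  rewrite !EopE; congr (_ + _).
    by apply: eq_bigr => u _; rewrite embV; exact/(congr1 (fun z => e u * f z))/invM.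
  by apply: eq_bigr => u _; rewrite embV; exact/(congr1 (fun z => e u * f z))/invM.
have dE (g h y : G) : dirac_fun R h (gmul (ginv g) y) = dirac_fun R (gmul g h) y.
  rewrite /dirac_fun; congr (if _ then _ else _); apply: asbool_equiv_eq.
  split=> [<-|->]; first by rewrite gmulA gmulxV gmul1x.
  by rewrite gmulA gmulVx gmul1x.
move=> y; rewrite big_cat !big_map/= /Top; congr (_ + _).
  rewrite /convG (@conv_comb R G [seq (e u, emb 0 u) | u <- S]); last first.
    by move=> z; rewrite big_map -pushE.
  by rewrite big_map; apply: eq_bigr => u _; rewrite dE.
rewrite /convG (@conv_comb R G [:: (1, ginv (wt' U))]); last first.
  by move=> z; rewrite big_seq1 mul1r.
rewrite big_seq1 mul1r pushE; apply: eq_bigr => u _; by rewrite dE.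
Qed.

(** [pi] is any label unchanged by left multiplication by the copy of [U] in position [i]: the
    exponent of [t], or the coordinate at another position. *)
Lemma Eop_supp (T : Type) (pi : G -> T) c i f :
  (forall u x, pi (gmul (emb i u) x) = pi x) ->
  (forall x, f x != 0 -> pi x = c) -> forall x, Eop i f x != 0 -> pi x = c.
Proof.
move=> piE fc x; apply: contra_neqP => nc; rewrite EopE big1// => u _.
have [->|/fc] := eqVneq (f (gmul (emb i (ginv u)) x)) 0; first by rewrite mulr0.
by rewrite piE.
Qed.

(** If [f] lives where coordinate [i] agrees with that of [g], only the term [u = 1] reaches [g].
    This is where each factor [alpha] of the traces arises. *)
Lemma Eop_local i f (g : G) :
  (forall x, f x != 0 -> wfun x i = wfun g i) -> Eop i f g = e gone * f g.
Proof.
move=> fg; have u1 u : f (gmul (emb i (ginv u)) g) != 0 -> u = gone.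
  move/fg; rewrite /= eqxx addr0 => h.
  by rewrite -[u]ginvK -[ginv u]gmulx1 -(gmulxV (wfun g i)) gmulA h gmulxV ginv1.
have fgE : f g = f (gmul (emb i (ginv gone)) g).
  congr f; apply: wreath_eq => [n|] /=; last by rewrite add0r.
  by rewrite ginv1 if_same gmul1x addr0.
rewrite EopE; have [gS|] := boolP (@gone U \in S).
  rewrite (big_fsetD1 gone)//= -fgE big_seq big1 ?addr0// => u.
  rewrite !inE => /andP[uy _]; apply/eqP; rewrite mulf_eq0; apply/orP; right.
  by apply: contraNT uy => /u1 ->.
rewrite mem_S negbK => /eqP e0; rewrite e0 mul0r big_seq big1// => u uS.
apply/eqP; rewrite mulf_eq0; apply/orP; right; apply: contraTT uS => /u1 ->.
by rewrite mem_S negbK e0.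
Qed.

Lemma run_supp (T : Type) (pi : G -> T) c s l f :
  (forall (k : nat) u x, (k < l)%N -> pi (gmul (emb (s + k%:Z) u) x) = pi x) ->
  (forall x, f x != 0 -> pi x = c) -> forall x, run Eop s l f x != 0 -> pi x = c.
Proof.
elim: l s => [//|l IH] s piE fc; apply: Eop_supp => [u x|].
  by rewrite -(piE 0%N u x)// addr0.
by apply: IH => // k u x kl; rewrite -(piE k.+1 u x)// -addrA -PoszD add1n.
Qed.

Lemma run_dirac s l (g : G) : run Eop s l (dirac_fun R g) g = e gone ^+ l.
Proof.
elim: l s => [|l IH] s; first by rewrite /= /dirac_fun asboolT.
rewrite /= Eop_local ?IH ?exprS//.
(* The inner factors sit at positions above [s], so they do not disturb coordinate [s]. *)
apply: run_supp => [k u x _ /=|x]; last first.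
  by rewrite /dirac_fun; case: asboolP => [->//|]; rewrite eqxx.
by case: eqP => [|_]; [lia|rewrite gmul1x addr0].
Qed.

Lemma adj_run s l : adj (run Eop s l) (run Eop s l).
Proof.
elim: l s => [|l IH] s; first exact: adj_id.
have := adj_comp (adj_E s) (IH (s + 1)); congr adj.
by apply/funext => f /=; rewrite -runE//; exact: EopC.
Qed.

(** The product is a self-adjoint idempotent, so its squared norm on a Dirac function is a diagonal
    coefficient. *)
Lemma run_norm s l g :
  pair (run Eop s l (dirac_fun R g)) (run Eop s l (dirac_fun R g)) = e gone ^+ l.
Proof.
have [_ ->] := adj_run s l (run Eop s l (dirac_fun R g)) (fin_dirac R g).
rewrite pair_dirac run_run; [|exact: EopEop|exact: EopC].
by rewrite run_dirac rmorphXn/= conj_e ginv1.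
Qed.

End Operators.

(** * Square-summable families *)

Section ComplexSums.
Variable R : realType.
Local Notation C := R[i].
Local Notation re := (@complex.Re R).
Local Notation im := (@complex.Im R).

Definition nsq (z : C) : R := re z ^+ 2 + im z ^+ 2.

(** Real and imaginary parts are bounded separately because [csum] is defined from them
    separately. *)
Definition cbd (z : C) (r : R) : Prop := `|re z| <= r /\ `|im z| <= r.

Lemma reD (z w : C) : re (z + w) = re z + re w. Proof. by case: z; case: w. Qed.
Lemma imD (z w : C) : im (z + w) = im z + im w. Proof. by case: z; case: w. Qed.
Lemma reN (z : C) : re (- z) = - re z. Proof. by case: z. Qed.
Lemma imN (z : C) : im (- z) = - im z. Proof. by case: z. Qed.
Lemma reM (z w : C) : re (z * w) = re z * re w - im z * im w.
Proof. by case: z; case: w. Qed.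
Lemma imM (z w : C) : im (z * w) = re z * im w + im z * re w.
Proof. by case: z; case: w. Qed.

Lemma re_sum I (r : seq I) (F : I -> C) : re (\sum_(i <- r) F i) = \sum_(i <- r) re (F i).
Proof. exact: (big_morph re reD). Qed.

Lemma im_sum I (r : seq I) (F : I -> C) : im (\sum_(i <- r) F i) = \sum_(i <- r) im (F i).
Proof. exact: (big_morph im imD). Qed.

Lemma complex_ext (z w : C) : re z = re w -> im z = im w -> z = w.
Proof. by case: z w => a b [c d] /= -> ->. Qed.

Lemma nsq_ge0 z : 0 <= nsq z.
Proof. by rewrite addr_ge0 ?sqr_ge0. Qed.

Lemma nsq_eq0 z : nsq z = 0 -> z = 0.
Proof.
move/eqP; rewrite paddr_eq0 ?sqr_ge0// !sqrf_eq0 => /andP[/eqP rz /eqP iz].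
exact: complex_ext.
Qed.

Lemma mulJ_nsq z : z * conjc z = (nsq z)%:C.
Proof. by apply: complex_ext; case: z => a b; rewrite /nsq /= ?reM ?imM /=; ring. Qed.

Lemma nsqD2 z w : nsq (z + w) <= 2 * nsq z + 2 * nsq w.
Proof.
 rewrite /nsq reD imD; move: (re z) (im z) (re w) (im w) => a b c d.
have := sqr_ge0 (a - c); have := sqr_ge0 (b - d).
by rewrite !expr2; lra.
Qed.

Lemma cbdD z w r s : cbd z r -> cbd w s -> cbd (z + w) (r + s).
Proof.
move=> [rz iz] [rw iw]; split; rewrite ?reD ?imD.
  by rewrite (le_trans (ler_normD _ _))// lerD.
by rewrite (le_trans (ler_normD _ _))// lerD.
Qed.

Lemma cbdN z r : cbd z r -> cbd (- z) r.
Proof. by rewrite /cbd reN imN !normrN. Qed.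

Lemma cbd_sum I (r : seq I) (F : I -> C) b : (forall i, cbd (F i) b) ->
  cbd (\sum_(i <- r) F i) (b *+ size r).
Proof.
move=> H; elim: r => [|i r IH]; first by rewrite big_nil /cbd normr0.
by rewrite big_cons mulrS; exact: cbdD.
Qed.

Lemma cbdW z r s : r <= s -> cbd z r -> cbd z s.
Proof. by move=> rs [rz iz]; split; exact: le_trans rs. Qed.

Lemma cbd_eq0 z : (forall eps, 0 < eps -> cbd z eps) -> z = 0.
Proof.
move=> H; have E (x : R) : (forall eps, 0 < eps -> `|x| <= eps) -> x = 0.
  move=> h; apply/eqP; rewrite -normr_le0; apply/ler_addgt0Pr => eps e0.
  by rewrite add0r h.
by apply: complex_ext; apply: E => eps /H [].
Qed.

(* AM-GM: [2 |z w| <= |z|^2 / r + r |w|^2]. *)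
Lemma cbd_mul (z w : C) r : 0 < r -> cbd (z * conjc w) ((nsq z / r + r * nsq w) / 2).
Proof.
move=> r0; have r0' := lt0r_neq0 r0.
have B (a b c d : R) : `|a * c + b * d| <=
    ((a ^+ 2 + b ^+ 2) / r + r * (c ^+ 2 + d ^+ 2)) / 2.
  have sq (x y : R) : `|x * y| <= (x ^+ 2 / r + r * y ^+ 2) / 2.
    have p : 0 <= (`|x| - r * `|y|) ^+ 2 / r by rewrite divr_ge0 ?sqr_ge0// ltW.
    have q : (`|x| - r * `|y|) ^+ 2 / r = x ^+ 2 / r + r * y ^+ 2 - 2 * (`|x| * `|y|).
      by rewrite -(real_normK (num_real x)) -(real_normK (num_real y)); field.
    by rewrite normrM; lra.
  have := sq a c; have := sq b d; have := ler_normD (a * c) (b * d); lra.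
rewrite /nsq; case: z w => a b [c d]; split; rewrite ?reM ?imM /=.
  have := B a b c d; by have -> : a * c - b * - d = a * c + b * d by ring.
have := B a b (- d) c; by rewrite sqrrN [d ^+ 2 + _]addrC.
Qed.

Section Families.
Variable T : choiceType.
Implicit Types (D : {fset T}) (h : T -> R) (f g : T -> C).

Lemma sum_fset_le h D D' : (forall x, 0 <= h x) -> (D `<=` D')%fset ->
  \sum_(x <- D) h x <= \sum_(x <- D') h x.
Proof.
move=> h0 DD; rewrite [leRHS](big_fsetID _ (mem D))/= -[leLHS]addr0 lerD ?sumr_ge0//.
rewrite (_ : [fset x in D' | x \in D]%fset = D)//.
apply/fsetP => x; rewrite !inE/= andbC; case: (boolP (x \in D)) => //=.
by move/(fsubsetP DD) ->.
Qed.

Lemma esum_approx h M : (forall x, 0 <= h x) -> (forall D, \sum_(x <- D) h x <= M) ->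
  exists2 s, fine (\esum_(x in [set: T]) (h x)%:E) = s &
    (forall D, \sum_(x <- D) h x <= s) /\
    forall eps, 0 < eps -> exists D0 : {fset T}, forall D, (D0 `<=` D)%fset ->
      s - eps <= \sum_(x <- D) h x.
Proof.
move=> h0 hM; set E := esum _ _; exists (fine E) => //.
have fs (X : set T) : finite_set X ->
    (\sum_(x \in X) (h x)%:E = (\sum_(x <- fset_set X) h x)%:E)%E.
  by move=> fX; rewrite fsbig_finite// sumEFin.
have E0 : (0 <= E)%E by apply: esum_ge0 => x _; rewrite lee_fin.
have EM : (E <= M%:E)%E.
  by apply: ge_ereal_sup => _ [X [fX _] <-]; rewrite fs// lee_fin.
have Efin : E \is a fin_num by rewrite ge0_fin_numE// (le_lt_trans EM) ?ltry.
have EE : E = (fine E)%:E by rewrite fineK.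
split=> [D|eps e0].
  rewrite -lee_fin -EE; apply: ereal_sup_ubound; exists [set` D]; first by split.
  by rewrite fs// set_fsetK.
have [_ [X [fX _] <-]] := ub_ereal_sup_adherent e0 Efin.
rewrite -/(esum _ _) -/E EE fs// -EFinB lte_fin => lt.
exists (fset_set X) => D XD; rewrite (le_trans (ltW lt))//.
exact: sum_fset_le.
Qed.

(** Bounded absolute sums make the positive and the negative part finite, whereas [fine] would send
    an infinite one to 0; after that the limit of the signed finite sums determines [rsum]. *)
Lemma rsum_lim h M s : (forall D, \sum_(x <- D) `|h x| <= M) ->
  (forall eps, 0 < eps -> exists D0 : {fset T}, forall D, (D0 `<=` D)%fset ->
     `|\sum_(x <- D) h x - s| <= eps) ->
  rsum h = s.
Proof.
move=> hM hs.
have bd (k : T -> R) : (forall x, k x <= `|h x|) -> forall D, \sum_(x <- D) k x <= M.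
  by move=> kh D; rewrite (le_trans _ (hM D))// ler_sum.
have pos (k : T -> R) x : 0 <= Num.max (k x) 0 by rewrite le_max lexx orbT.
have kp x : Num.max (h x) 0 <= `|h x| by rewrite ge_max ler_norm normr_ge0.
have kn x : Num.max (- h x) 0 <= `|h x| by rewrite ge_max -normrN ler_norm normr_ge0.
have [P EP [PD Pe]] := esum_approx (pos h) (bd _ kp).
have [N EN [ND Ne]] := esum_approx (pos (fun x => - h x)) (bd _ kn).
rewrite /rsum EP EN; apply/eqP; rewrite -subr_eq0 -normr_le0; apply/ler_addgt0Pr => eps e0.
have e3 : 0 < eps / 3 by rewrite divr_gt0.
have [D1 H1] := Pe _ e3; have [D2 H2] := Ne _ e3; have [D3 H3] := hs _ e3.
pose D := (D1 `|` D2 `|` D3)%fset.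
have S1 : (D1 `<=` D)%fset by rewrite /D -fsetUA fsubsetUl.
have S2 : (D2 `<=` D)%fset by rewrite /D [(D1 `|` D2)%fset]fsetUC -fsetUA fsubsetUl.
have S3 : (D3 `<=` D)%fset by rewrite fsubsetUr.
have sumE : \sum_(x <- D) h x =
    \sum_(x <- D) Num.max (h x) 0 - \sum_(x <- D) Num.max (- h x) 0.
  rewrite -sumrB; apply: eq_bigr => x _; rewrite /Num.max oppr_lt0.
  by have [h0|h0|->] := ltgtP (h x) 0; rewrite ?sub0r ?opprK ?subr0 ?oppr0 ?subr0.
have := H3 _ S3; rewrite sumE; have := H1 _ S1; have := H2 _ S2.
have := PD D; have := ND D.
set u := \sum_(x <- D) _; set v := \sum_(x <- D) _ => ? ? ? ?.
by rewrite !ler_norml => /andP[? ?]; apply/andP; split; lra.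
Qed.

Lemma csum_lim f M s : (forall D, \sum_(x <- D) `|re (f x)| <= M) ->
  (forall D, \sum_(x <- D) `|im (f x)| <= M) ->
  (forall eps, 0 < eps -> exists D0 : {fset T}, forall D, (D0 `<=` D)%fset ->
     cbd (\sum_(x <- D) f x - s) eps) ->
  csum f = s.
Proof.
move=> rM iM hs; rewrite /csum.
rewrite (@rsum_lim _ M (re s) rM); last first.
  move=> eps /hs[D0 H]; exists D0 => D /H[+ _].
  by rewrite reD reN re_sum.
rewrite (@rsum_lim _ M (im s) iM); last first.
  move=> eps /hs[D0 H]; exists D0 => D /H[_].
  by rewrite imD imN im_sum.
by apply: complex_ext; rewrite ?reD ?imD ?reM ?imM /=; ring.
Qed.

(** Square-summability is used below as a uniform bound on finite sums; [bound_l2] goes back. *)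
Lemma l2_bound f : l2 f -> exists M, forall D, \sum_(x <- D) nsq (f x) <= M.
Proof.
rewrite /l2 => fin; set E := esum _ _ in fin.
have E0 : (0 <= E)%E by apply: esum_ge0 => x _; rewrite lee_fin nsq_ge0.
exists (fine E) => D; rewrite -lee_fin fineK ?ge0_fin_numE//.
apply: ereal_sup_ubound; exists [set` D]; first by split.
by rewrite fsbig_finite// set_fsetK sumEFin.
Qed.

Lemma bound_l2 f M : (forall D, \sum_(x <- D) nsq (f x) <= M) -> l2 f.
Proof.
move=> fM; rewrite /l2; apply: (@le_lt_trans _ _ M%:E); last exact: ltry.
apply: ge_ereal_sup => _ [X [fX _] <-].
by rewrite fsbig_finite// sumEFin lee_fin.
Qed.

(** Cauchy-Schwarz without square roots; the weight [r] is chosen at each use to balance the two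
    terms. *)
Lemma cbd_sum_mul f g (D : {fset T}) r A B : 0 < r ->
  \sum_(x <- D) nsq (f x) <= A -> \sum_(x <- D) nsq (g x) <= B ->
  cbd (\sum_(x <- D) f x * conjc (g x)) ((A / r + r * B) / 2).
Proof.
move=> r0 fA gB.
apply: (@cbdW _ (\sum_(x <- D) (nsq (f x) / r + r * nsq (g x)) / 2)).
  rewrite -mulr_suml big_split/= -mulr_suml -mulr_sumr.
  rewrite ler_pM2r ?invr_gt0 ?ltr0n// lerD//.
    by rewrite ler_pM2r ?invr_gt0.
  by rewrite ler_pM2l.
apply: (big_ind2 cbd) => [|*|x _]; first by rewrite /cbd normr0.
  exact: cbdD.
exact: cbd_mul.
Qed.

Lemma inner_lim f g M B s : (forall D, \sum_(x <- D) nsq (f x) <= M) ->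
  (forall D, \sum_(x <- D) nsq (g x) <= B) ->
  (forall eps, 0 < eps -> exists D0 : {fset T}, forall D, (D0 `<=` D)%fset ->
     cbd (\sum_(x <- D) f x * conjc (g x) - s) eps) ->
  inner f g = s.
Proof.
move=> fM gB hs; have b x : cbd (f x * conjc (g x)) ((nsq (f x) + nsq (g x)) / 2).
  by have := cbd_mul (f x) (g x) ltr01; rewrite divr1 mul1r.
have tot D : \sum_(x <- D) (nsq (f x) + nsq (g x)) / 2 <= (M + B) / 2.
  by rewrite -mulr_suml big_split/= ler_pM2r ?invr_gt0 ?ltr0n// lerD.
apply: (@csum_lim _ ((M + B) / 2)) => // D.
  by rewrite (le_trans _ (tot D))// ler_sum// => x _; have [] := b x.
by rewrite (le_trans _ (tot D))// ler_sum// => x _; have [] := b x.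
Qed.

Lemma inner_fin f g (D0 : {fset T}) : (forall x, x \notin D0 -> f x * conjc (g x) = 0) ->
  inner f g = \sum_(x <- D0) f x * conjc (g x).
Proof.
move=> z; set F := fun x => f x * conjc (g x).
have S D : (D0 `<=` D)%fset -> \sum_(x <- D) F x = \sum_(x <- D0) F x.
  move=> DD; rewrite (big_fset_incl _ DD)// => x _; exact: z.
have B (k : C -> R) : k 0 = 0 -> exists M, forall D, \sum_(x <- D) `|k (F x)| <= M.
  move=> k0; exists (\sum_(x <- D0) `|k (F x)|) => D.
  apply: (@le_trans _ _ (\sum_(x <- (D `|` D0)%fset) `|k (F x)|)).
    by apply: sum_fset_le => //; exact: fsubsetUl.
  rewrite (big_fset_incl _ (fsubsetUr D D0))// => x _ xD.
  by rewrite /F z// k0 normr0.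
have [M1 H1] := B re erefl; have [M2 H2] := B im erefl.
apply: (@csum_lim _ (Num.max M1 M2)) => [D|D|eps e0].
- by rewrite le_max H1.
- by rewrite le_max H2 orbT.
- by exists D0 => D DD; rewrite S// subrr /cbd normr0 ltW.
Qed.

End Families.
End ComplexSums.

(** * The path model realised on functions on the wreath product *)

Section Eigenvectors.
Variables (R : realType) (U : grp) (e : U -> R[i]).
Local Notation C := R[i].
Local Notation G := (wgrp U).
Hypothesis fin_e : @in_group_algebra R U e.
Hypothesis star_e : @gstar R U (@ginv U) e = e.
Hypothesis idem_e : forall u, @convU R U e e u = e u.

Local Notation S := (fset_set (supp e)).
Local Notation V := (G -> C).

Definition EL i : {linear V -> V} := Eop e i.
Definition tL : {linear V -> V} := ltr (wt' U).
Definition tL' : {linear V -> V} := ltr (ginv (wt' U)).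
Local Notation t := (tL : V -> V).
Local Notation t' := (tL' : V -> V).
Local Notation delta := (@dirac_fun R G).
Local Notation fin a := (@in_group_algebra R G a).

Let EE : forall i v, EL i (EL i v) = EL i v := EopEop fin_e idem_e.
Let EC : forall i j v, EL i (EL j v) = EL j (EL i v) := @EopC R U e.
Let Et : forall i v, EL i (tL v) = tL (EL (i + 1) v) := @Eop_t R U e.
Let tK : cancel tL tL' := ltrVK (wt' U).
Let t'K : cancel tL' tL := ltrKV (wt' U).

Definition wrun (i : int) (l : nat) (v : V) : V := run EL i l v.
Definition wblock (i : int) (m : nat) (v : V) : V := block EL i m v.
Definition wstep (v : V) : V := step EL tL tL' v.

Lemma wstep_linear : linear wstep.
Proof. exact: step_linear. Qed.

HB.instance Definition _ := GRing.isLinear.Build C V V *:%R wstep wstep_linear.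

Lemma conv_wstep f x : convG (@Top R U e) f x = wstep f x.
Proof. exact: conv_Top. Qed.

Lemma wblockE i m v x : wblock i m v x =
  wrun (i + 1) m v x - wrun i m.+1 v x - wrun (i + 1) m.+1 v x + wrun i m.+2 v x.
Proof. by []. Qed.

Lemma wblock_conj b m v : iter b t (wblock 0 m (iter b t' v)) = wblock (- b%:Z) m v.
Proof. exact: block_conj t'K Et b m v. Qed.

Lemma sum_wblocks K v : \sum_(m < K) \sum_(b < m.+1) wblock (- b%:Z) m v =
  v - (\sum_(b < K.+1) wrun (1 - b%:Z) K v - \sum_(b < K) wrun (- b%:Z) K.+1 v).
Proof. exact: (sum_blocks EL). Qed.

Lemma wstep_eigen (mu : C) m v : cheb mu m.+1 = 0 ->
  wstep (\sum_(i < m.+1) cheb mu i *: iter i t (wblock 0 m v)) =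
  mu *: \sum_(i < m.+1) cheb mu i *: iter i t (wblock 0 m v).
Proof. exact: (step_eigen tK EE EC Et). Qed.

Lemma wblock_eigen (mu : C) m v : wstep v = mu *: v ->
  (forall i, (i <= m)%N -> wblock 0 m (iter i t' v) = cheb mu i *: wblock 0 m v) /\
  cheb mu m.+1 *: wblock 0 m v = 0.
Proof. exact: (block_eigen tK t'K EE EC Et). Qed.

Lemma adj_wrun i l : adj (wrun i l) (wrun i l).
Proof. exact: (adj_run fin_e star_e). Qed.

Lemma wrun_norm i l g : pair (wrun i l (delta g)) (wrun i l (delta g)) = e gone ^+ l.
Proof. exact: (run_norm fin_e star_e idem_e). Qed.

Lemma wrun_dirac i l g : wrun i l (delta g) g = e gone ^+ l.
Proof. exact: (run_dirac fin_e). Qed.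

Lemma wrun_exp i l f (k : int) : (forall x : G, f x != 0 -> wexp x = k) ->
  forall x : G, wrun i l f x != 0 -> wexp x = k.
Proof. by apply: run_supp => // j u y _ /=; rewrite add0r. Qed.

Definition alpha : R := complex.Re (e gone).

(** Evaluate [e e = e] at 1: the sum of [e(u) e(u^-1)] is the sum of the [|e(u)|^2], because [e] is
    self-adjoint. In particular [e(1)] is real. *)
Lemma e_one_sum : e gone = (\sum_(u <- S) nsq (e u))%:C.
Proof.
rewrite -[LHS]idem_e /convU (@conv_comb _ _ [seq (e u, u) | u <- S]).
  rewrite big_map rmorph_sum; apply: eq_bigr => u _ /=.
  by rewrite gmulx1 -(conj_e star_e) mulJ_nsq.
by move=> z; rewrite big_map -e_sum.
Qed.

Lemma alphaE : e gone = alpha%:C.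
Proof. by rewrite /alpha e_one_sum. Qed.

Hypothesis e_neq0 : e <> (fun _ => 0).
Hypothesis e_neq1 : e <> @dirac_fun R U (@gone U).

Lemma alpha_sum : alpha = \sum_(u <- S) nsq (e u).
Proof. by rewrite /alpha e_one_sum. Qed.

Lemma alpha_gt0 : 0 < alpha.
Proof.
rewrite lt_neqAle alpha_sum sumr_ge0 ?andbT => [|u _]; last exact: nsq_ge0.
apply/eqP => /esym/eqP; rewrite psumr_eq0 => [/allP H|u _]; last exact: nsq_ge0.
apply: e_neq0; apply/funext => u; apply/eqP/negPn/negP => eu.
have /H/implyP : u \in S by rewrite mem_S.
by move/(_ isT)/eqP/nsq_eq0 => /eqP; rewrite (negbTE eu).
Qed.

(** One has [alpha = alpha^2 + s], where [s] is the sum of [|e(u)|^2] over [u] different from 1. If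
    [alpha >= 1], then [s = 0] and [alpha = 1], so that [e] would be the unit. *)
Lemma alpha_lt1 : alpha < 1.
Proof.
have gS : gone \in S.
  rewrite mem_S// alphaE; apply: contraTneq alpha_gt0 => /(congr1 (@complex.Re R))/= ->.
  by rewrite ltxx.
have := alpha_sum; rewrite (big_fsetD1 gone)//= alphaE.
have -> : nsq alpha%:C = alpha ^+ 2 by rewrite /nsq/= expr0n addr0.
set s := \sum_(_ <- _) _ => eq.
have s0 : 0 <= s by apply: sumr_ge0 => u _; exact: nsq_ge0.
have [//|a1] := ltP alpha 1; have a0 := alpha_gt0.
have s00 : s = 0.
  apply/eqP; rewrite eq_le s0 andbT.
  have : 0 <= alpha * (alpha - 1) by rewrite mulr_ge0 ?subr_ge0// ltW.
  by move: eq; rewrite expr2; lra.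
have a11 : alpha = 1.
  by move: eq; rewrite s00 addr0 expr2 -{1}[alpha]mulr1 => /(mulfI (lt0r_neq0 a0)).
exfalso; apply: e_neq1; apply/funext => u; rewrite /dirac_fun.
case: asboolP => [->|ug]; first by rewrite alphaE a11.
apply/eqP/negPn/negP => eu; move/eqP: s00.
rewrite /s psumr_eq0 => [/allP/(_ u)|v _]; last exact: nsq_ge0.
rewrite !inE mem_S// eu andbT => /(_ _)/implyP.
have -> : u != gone by apply/eqP.
by move=> /(_ isT isT)/eqP/nsq_eq0 => /eqP; rewrite (negbTE eu).
Qed.

Lemma adjD (A A' B B' : (G -> C) -> G -> C) : adj A A' -> adj B B' ->
  adj (fun a => A a + B a) (fun q => A' q + B' q).
Proof.
move=> HA HB a q fa; have [fA eA] := HA a q fa; have [fB eB] := HB a q fa.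
by split; [exact: finD|rewrite pairDl// pairDr// eA eB].
Qed.

Lemma adjN (A A' : (G -> C) -> G -> C) : adj A A' ->
  adj (fun a => - A a) (fun q => - A' q).
Proof.
move=> HA a q fa; have [fA eA] := HA a q fa; split.
  by rewrite -scaleN1r; exact: finZ.
by rewrite -(scaleN1r (A a)) -(scaleN1r (A' q)) pairZl// pairZr eA (rmorphN1 (@conjc R)).
Qed.

Lemma adj_block s m : adj (wblock s m) (wblock s m).
Proof.
have H := adj_wrun.
have e1 : wblock s m = fun v => wrun (s + 1) m v + - wrun s m.+1 v + - wrun (s + 1) m.+1 v
    + wrun s m.+2 v by apply/funext.
rewrite e1; apply: (@adjD _ _ (wrun s m.+2)); last exact: H.
apply: (@adjD _ _ (fun v => - wrun (s + 1) m.+1 v)); last exact/adjN/H.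
by apply: (@adjD _ _ (fun v => - wrun s m.+1 v)); [exact: H|exact/adjN/H].
Qed.

Lemma adj_t : adj t t'.
Proof. exact: adj_ltr. Qed.

Lemma adj_t' : adj t' t.
Proof. by have := @adj_ltr R G (ginv (wt' U)); rewrite ginvK. Qed.

Lemma iterZ (h : {linear (G -> C) -> (G -> C)}) n (c : C) f :
  iter n h (c *: f) = c *: iter n h f.
Proof. by elim: n => [//|n IH] /=; rewrite IH linearZ. Qed.

Lemma block_dirac s m (g : G) : wblock s m (delta g) g = (alpha ^+ m * (1 - alpha) ^+ 2)%:C.
Proof.
have H s' l : wrun s' l (delta g) g = (alpha ^+ l)%:C by rewrite wrun_dirac alphaE rmorphXn.
rewrite wblockE !H.
by rewrite -!rmorphB -rmorphD; congr _%:C; rewrite !exprS; ring.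
Qed.

Lemma block_exp s m f k : (forall x : G, f x != 0 -> wexp x = k) ->
  forall x, wblock s m f x != 0 -> wexp x = k.
Proof.
move=> fk x; apply: contra_neqP => nk.
have H s' l : wrun s' l f x = 0.
  by apply: contra_notP nk => /eqP; exact: wrun_exp.
rewrite wblockE !H; by rewrite !subr0 addr0.
Qed.

Lemma iter_t_exp n f k : (forall x : G, f x != 0 -> wexp x = k) ->
  forall x : G, iter n t f x != 0 -> wexp x = k + n%:Z.
Proof.
elim: n => [|n IH] fk x; first by rewrite addr0; exact: fk.
move/(IH fk) => /=; lia.
Qed.

Lemma iter_t'_exp n f k : (forall x : G, f x != 0 -> wexp x = k) ->
  forall x : G, iter n t' f x != 0 -> wexp x = k - n%:Z.
Proof.
elim: n => [|n IH] fk x; first by rewrite subr0; exact: fk.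
move/(IH fk) => /=; lia.
Qed.

(** Moving from vertex [b] to vertex [i] changes the exponent of [t] by [i - b], so only [i = b] can
    contribute at [g]. *)
Lemma vertex_dirac m (i b : nat) (g : G) :
  iter i t (wblock 0 m (iter b t' (delta g))) g =
  if i == b then (alpha ^+ m * (1 - alpha) ^+ 2)%:C else 0.
Proof.
case: eqP => [->|ib]; first by rewrite wblock_conj block_dirac.
apply: contra_notP ib => /eqP.
have d x : delta g x != 0 -> wexp x = wexp g.
  by rewrite /dirac_fun; case: asboolP => [->//|]; rewrite eqxx.
move/(iter_t_exp (block_exp (iter_t'_exp d))); lia.
Qed.

(** * Approximate projections onto the eigenspace of a fixed [mu] *)

Section FixedEigenvalue.
Variable mu : R.
Local Notation s := (cheb mu).
Local Notation T := wstep.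

(** Squared norm of [(s 0, ..., s m)], which is the [mu]-eigenvector of the path when
    [s m.+1 = 0]. *)
Definition pathnorm m : R := \sum_(i < m.+1) s i ^+ 2.

Lemma pathnorm_gt0 m : 0 < pathnorm m.
Proof.
rewrite /pathnorm big_ord_recl/= expr1n ltr_pwDl//.
by apply: sumr_ge0 => i _; exact: sqr_ge0.
Qed.

(** Takes the component of [v] on vertex [b] back to vertex 0 and spreads it along the path with the
    weights of the eigenvector. *)
Definition pathvec m b (v : G -> C) : G -> C :=
  \sum_(i < m.+1) (s i)%:C *: iter i t (wblock 0 m (iter b t' v)).

Lemma cheb_complex i : cheb (mu%:C : C) i = (s i)%:C.
Proof. by rewrite -(rmorph_cheb (real_complex R)). Qed.

Lemma step_pathvec m b v : s m.+1 = 0 -> T (pathvec m b v) = mu%:C *: pathvec m b v.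
Proof.
move=> root; have := @wstep_eigen mu%:C m (iter b t' v).
rewrite cheb_complex root => /(_ erefl).
by under eq_bigr do rewrite cheb_complex.
Qed.

Lemma adj_pathvec m b : adj (pathvec m b)
  (fun q => \sum_(i < m.+1) (s i)%:C *: iter b t (wblock 0 m (iter i t' q))).
Proof.
have := @adj_sum R G _ (index_enum 'I_m.+1) (fun i => (s i)%:C)
  (fun i v => iter i t (wblock 0 m (iter b t' v)))
  (fun i q => iter b t (wblock 0 m (iter i t' q))).
move=> /(_ _)H a q fa; have [|f1 f2] := H _ a q fa.
  move=> i; exact: adj_comp (adj_iter i adj_t) (adj_comp (adj_block 0 m) (adj_iter b adj_t')).
split=> //; rewrite f2; congr pair; apply: eq_bigr => i _.
by rewrite conjc_real.
Qed.

(* The component of [v] on vertex [b] of the paths with [m + 1] vertices,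
   projected onto the [mu]-eigenspace. *)
Definition proj m b (v : G -> C) : G -> C :=
  if s m.+1 == 0 then (s b / pathnorm m)%:C *: pathvec m b v else 0.

Lemma fin_pathvec m b a : fin a -> fin (pathvec m b a).
Proof. by move=> fa; have [] := adj_pathvec m b (0 : G -> C) fa. Qed.

Lemma fin0 : fin (0 : G -> C).
Proof. by apply: (@sub_finite_set _ _ set0) => // x; rewrite /supp/= eqxx. Qed.

Lemma fin_proj m b a : fin a -> fin (proj m b a).
Proof.
move=> fa; rewrite /proj; case: ifP => _; last exact: fin0.
exact/finZ/fin_pathvec.
Qed.

Lemma step_proj m b v : T (proj m b v) = mu%:C *: proj m b v.
Proof.
rewrite /proj; case: eqP => [root|_]; last by rewrite scaler0 linear0.
by rewrite linearZ/= step_pathvec// !scalerA mulrC.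
Qed.

(** An eigenvector [q] does not notice the projection. By [wblock_eigen] its components along the
    path are proportional to the [s i], so the pairing produces the sum of the [s i ^+ 2], which
    cancels [pathnorm m]; if [mu] is not an eigenvalue of the path, [q] has no component there at
    all. *)
Lemma pair_proj m b a q : (b <= m)%N -> fin a -> T q = mu%:C *: q ->
  pair (proj m b a) q = pair (wblock (- b%:Z) m a) q.
Proof.
move=> bm fa ev.
have [wE wroot] := @wblock_eigen mu%:C m q ev.
have {}wE i : (i <= m)%N -> iter b t (wblock 0 m (iter i t' q)) = (s i)%:C *: iter b t (wblock 0 m q).
  by move=> im; rewrite wE// iterZ cheb_complex.
have -> : pair (wblock (- b%:Z) m a) q = pair a ((s b)%:C *: iter b t (wblock 0 m q)).
  rewrite -wblock_conj.
  have [_] := adj_comp (adj_iter b adj_t) (adj_comp (adj_block 0 m) (adj_iter b adj_t')) q fa.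
  by move=> /= ->; rewrite wE.
rewrite /proj; case: eqP => [root|/eqP root]; last first.
  have -> : wblock 0 m q = 0.
    move: wroot; rewrite cheb_complex => /(congr1 (fun x => ((s m.+1)%:C^-1) *: x)).
    rewrite scalerA mulVf ?scale1r ?scaler0//.
    by rewrite (inj_eq (@complexI R)).
  rewrite -[X in iter b t X](scale0r (0 : G -> C)) iterZ scale0r scaler0.
  rewrite -[X in pair a X](scale0r (0 : G -> C)) pairZr conjc0 mul0r.
  by rewrite -[X in pair X q](scale0r (0 : G -> C)) pairZl ?mul0r//; exact: fin0.
rewrite pairZl; last exact: fin_pathvec.
have [_ ->] := adj_pathvec m b q fa.
under eq_bigr => i _ do rewrite wE -1?ltnS// scalerA -rmorphM.
rewrite -scaler_suml -rmorph_sum !pairZr !conjc_real mulrA -rmorphM; congr (_%:C * _).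
rewrite -[RHS]mulr1 -(mulVf (lt0r_neq0 (pathnorm_gt0 m))) mulrA; congr (_ * _).
Qed.

(** Approximates the projection of [v] onto the [mu]-eigenspace by means of the paths with at most
    [K] vertices. *)
Definition partial K (v : G -> C) : G -> C := \sum_(m < K) \sum_(b < m.+1) proj m b v.

(* The component of [v] on the paths with more than [K] vertices. *)
Definition rest K (v : G -> C) : G -> C :=
  \sum_(b < K.+1) wrun (1 - b%:Z) K v - \sum_(b < K) wrun (- b%:Z) K.+1 v.

Lemma fin_partial K a : fin a -> fin (partial K a).
Proof. by move=> fa; apply: fin_sum => m; apply: fin_sum => b; exact: fin_proj. Qed.

Lemma fin_run i l a : fin a -> fin (wrun i l a).
Proof. by move=> fa; have [] := adj_wrun i l (0 : G -> C) fa. Qed.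

Lemma fin_block i l a : fin a -> fin (wblock i l a).
Proof. by move=> fa; have [] := adj_block i l (0 : G -> C) fa. Qed.

Lemma fin_rest K a : fin a -> fin (rest K a).
Proof. by move=> fa; apply: finB; apply: fin_sum => b; exact: fin_run. Qed.

Lemma step_partial K v : T (partial K v) = mu%:C *: partial K v.
Proof.
rewrite /partial linear_sum/= scaler_sumr; apply: eq_bigr => m _.
rewrite linear_sum/= scaler_sumr; apply: eq_bigr => b _; exact: step_proj.
Qed.

Lemma pair_blocks K a q : fin a ->
  \sum_(m < K) \sum_(b < m.+1) pair (wblock (- b%:Z) m a) q = pair a q - pair (rest K a) q.
Proof.
move=> fa; rewrite -pairBl//; last exact: fin_rest.
rewrite /rest -sum_wblocks pair_suml => [|m]; last by apply: fin_sum => b; exact: fin_block.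
by apply: eq_bigr => m _; rewrite pair_suml// => b; exact: fin_block.
Qed.

Lemma pair_partial K a q : fin a -> T q = mu%:C *: q ->
  pair (partial K a) q = pair a q - pair (rest K a) q.
Proof.
move=> fa ev; rewrite -pair_blocks// /partial pair_suml => [|m]; last first.
  by apply: fin_sum => b; exact: fin_proj.
apply: eq_bigr => m _; rewrite pair_suml => [|b]; last exact: fin_proj.
by apply: eq_bigr => b _; rewrite pair_proj// -ltnS.
Qed.

(** Only the diagonal entries [s b ^+ 2 / pathnorm m] of the eigenprojection of the path matter at
    [g], and they add up to 1: each length with eigenvalue [mu] contributes the trace of one
    vertex. *)
Lemma partial_dirac K (g : G) : partial K (delta g) g =
  (\sum_(m < K | s m.+1 == 0) alpha ^+ m * (1 - alpha) ^+ 2)%:C.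
Proof.
rewrite /partial fct_sumE rmorph_sum [RHS]big_mkcond; apply: eq_bigr => m _.
rewrite fct_sumE /proj; case: ifP => _; last by rewrite big1.
transitivity (\sum_(b < m.+1) (s b ^+ 2 / pathnorm m * (alpha ^+ m * (1 - alpha) ^+ 2))%:C).
  apply: eq_bigr => b _; rewrite fctE /pathvec fct_sumE (bigD1 b)//= big1 => [|i ib].
    rewrite addr0 fctE vertex_dirac eqxx.
    by rewrite -[LHS]/(_%:C * (_%:C * _%:C)) -!rmorphM; congr _%:C; ring.
  by rewrite fctE vertex_dirac (inj_eq val_inj) (negbTE ib) scaler0.
rewrite -rmorph_sum -mulr_suml -mulr_suml; congr _%:C.
by rewrite divff ?mul1r// lt0r_neq0// pathnorm_gt0.
Qed.

End FixedEigenvalue.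
End Eigenvectors.

(** * Projections onto the eigenspaces *)

Section RealLimits.
Variable R : realType.

Lemma expr_small (x : R) : 0 <= x < 1 -> forall eps, 0 < eps ->
  exists K0, forall K, (K0 <= K)%N -> x ^+ K <= eps.
Proof.
move=> /andP[x0 x1] eps e0.
have xn : `|x| < 1 by rewrite ger0_norm.
have /cvgrPdistC_le/(_ _ e0)[K0 _ H] := cvg_expr xn.
by exists K0 => K /H/=; rewrite subr0 ger0_norm// exprn_ge0.
Qed.

(** Each of the [K] terms of [1 + x + ... + x^(K-1)] is at least [x^K]. *)
Lemma natM_expr_le (x : R) K : 0 <= x < 1 -> K%:R * x ^+ K * (1 - x) <= 1 - x ^+ K.
Proof.
move=> /andP[x0 x1]; elim: K => [|K IH]; first by rewrite !mul0r expr0 subrr.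
have xK : x ^+ K.+1 <= 1 by rewrite exprn_ile1// ltW.
have := ler_wpM2l x0 IH; move: xK; rewrite -natr1 !exprS.
set y := x ^+ K; set k := K%:R => xK H.
have : 0 <= (1 - x) * (1 - x * y) by rewrite mulr_ge0// subr_ge0// ltW.
by move: H; lra.
Qed.

(** With [x = y^2], one factor [y^K] absorbs the linear growth and the other tends to 0. *)
Lemma natM_expr_small (x : R) : 0 <= x < 1 -> forall eps, 0 < eps ->
  exists K0, forall K, (K0 <= K)%N -> (K.+1 + K)%:R * x ^+ K <= eps.
Proof.
move=> /andP[x0 x1] eps e0; set y := Num.sqrt x.
have y0 : 0 <= y := sqrtr_ge0 x.
have yx : x = y ^+ 2 by rewrite sqr_sqrtr.
have y1 : y < 1 by rewrite -sqrtr1 ltr_sqrt.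
have c0 : 0 < 1 - y by rewrite subr_gt0.
(* An upper bound for [(2 K + 1) y^K], from [K y^K <= 1 / (1 - y)] and [y^K <= 1]. *)
set c := 2 / (1 - y) + 1; have cp : 0 < c by rewrite addr_gt0// divr_gt0.
have y01 : 0 <= y < 1 by rewrite y0.
have [K0 H] := expr_small y01 (divr_gt0 e0 cp).
exists K0 => K /H; rewrite ler_pdivlMr// => le; apply: le_trans le.
have b := natM_expr_le K y01; have yK : 0 <= y ^+ K by rewrite exprn_ge0.
have yK1 : y ^+ K <= 1 by rewrite exprn_ile1// ltW.
rewrite yx exprAC expr2 mulrA [leRHS]mulrC; apply: ler_wpM2r => //.
have b' : K%:R * y ^+ K <= (1 - y)^-1.
  by rewrite -ler_pdivlMr// in b; rewrite (le_trans b)// ler_pdivrMr// mulVf ?lt0r_neq0//; lra.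
rewrite natrD -natr1 /c; set z := (1 - y)^-1 in b' *; set u := y ^+ K in b' yK1 *.
have -> : (K%:R + 1 + K%:R) * u = 2 * (K%:R * u) + u by ring.
lra.
Qed.

Lemma real_cauchy (u : nat -> R) :
  (forall eps, 0 < eps -> exists N, forall n, (N <= n)%N -> `|u n - u N| <= eps) ->
  exists l, forall eps, 0 < eps -> exists N, forall n, (N <= n)%N -> `|u n - l| <= eps.
Proof.
move=> H; have : cvg (u @ \oo).
  apply/cauchy_cvgP/cauchy_exP => eps e0.
  have [N HN] := H _ (divr_gt0 e0 (ltr0Sn R 1)).
  exists (u N); exists N => // n /= Nn; rewrite -ball_normE /ball_/=.
  by rewrite distrC (le_lt_trans (HN n Nn))// ltr_pdivrMr// ltr_pMr// ltr1n.
move=> cu; exists (lim (u @ \oo)) => eps e0.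
by have /cvgrPdistC_le/(_ _ e0)[N _ HN] := cu; exists N => n /HN.
Qed.

Lemma complex_cauchy (u : nat -> R[i]) :
  (forall eps, 0 < eps -> exists N, forall n, (N <= n)%N -> nsq (u n - u N) <= eps) ->
  exists l, forall eps, 0 < eps -> exists N, forall n, (N <= n)%N -> nsq (u n - l) <= eps.
Proof.
move=> H.
have sq (x eps : R) : 0 < eps -> x ^+ 2 <= eps ^+ 2 -> `|x| <= eps.
  by move=> e0; rewrite -[x ^+ 2]real_normK ?num_real// ler_sqr ?nnegrE ?normr_ge0 ?(ltW e0).
have [|a Ha] := @real_cauchy (fun n => complex.Re (u n)).
  move=> eps e0; have [N HN] := H _ (exprn_gt0 2 e0); exists N => n /HN.
  rewrite /nsq reD reN imD imN => b; apply: sq => //; apply: le_trans b.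
  by rewrite lerDl sqr_ge0.
have [|b Hb] := @real_cauchy (fun n => complex.Im (u n)).
  move=> eps e0; have [N HN] := H _ (exprn_gt0 2 e0); exists N => n /HN.
  rewrite /nsq reD reN imD imN => b; apply: sq => //; apply: le_trans b.
  by rewrite lerDr sqr_ge0.
exists (Complex a b) => eps e0; set d := Num.sqrt (eps / 2).
have d2 : d ^+ 2 = eps / 2 by rewrite sqr_sqrtr// divr_ge0// ltW.
have d0 : 0 < d by rewrite sqrtr_gt0 divr_gt0.
have [N1 H1] := Ha _ d0; have [N2 H2] := Hb _ d0.
exists (maxn N1 N2) => n; rewrite geq_max => /andP[/H1 h1 /H2 h2].
have sq' (x : R) : `|x| <= d -> x ^+ 2 <= eps / 2.
  by move=> xd; rewrite -d2 -[x ^+ 2]real_normK ?num_real// ler_sqr ?nnegrE ?normr_ge0 ?(ltW d0).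
rewrite /nsq reD reN imD imN /=; have := sq' _ h1; have := sq' _ h2.
lra.
Qed.

End RealLimits.

(** * Convergence of the approximate projections of a Dirac function *)

Section Limit.
Variables (R : realType) (U : grp) (e : U -> R[i]).
Local Notation C := R[i].
Local Notation G := (wgrp U).
Local Notation V := (G -> C).
Hypothesis fin_e : @in_group_algebra R U e.
Hypothesis star_e : @gstar R U (@ginv U) e = e.
Hypothesis idem_e : forall u, @convU R U e e u = e u.
Hypothesis e_neq0 : e <> (fun _ => 0).
Hypothesis e_neq1 : e <> @dirac_fun R U (@gone U).
Local Notation delta := (@dirac_fun R G).
Local Notation fin a := (@in_group_algebra R G a).
Local Notation alpha := (alpha e).
Local Notation T := (wstep e).

Let rho : R := Num.sqrt alpha.

Lemma rho_bounds : 0 < rho < 1.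
Proof.
have a0 := alpha_gt0 fin_e star_e idem_e e_neq0.
have a1 := alpha_lt1 fin_e star_e idem_e e_neq0 e_neq1.
by rewrite sqrtr_gt0 a0 -sqrtr1 ltr_sqrt.
Qed.

(** [rest K] consists of [K + 1] products of [K] factors and [K] products of [K + 1] factors, each
    of norm at most [rho^K] on a Dirac function. *)
Definition eta K : R := (K.+1 + K)%:R * rho ^+ K.

Lemma eta_small eps : 0 < eps -> exists K0, forall K, (K0 <= K)%N -> eta K <= eps.
Proof. by apply: natM_expr_small; have /andP[/ltW -> ->] := rho_bounds. Qed.

Lemma pair_self (a : V) (D : {fset G}) : (forall x : G, a x != 0 -> x \in D) ->
  pair a a = (\sum_(x <- D) nsq (a x))%:C.
Proof.
move=> aD; rewrite (pairE _ aD) rmorph_sum; apply: eq_bigr => x _.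
exact: mulJ_nsq.
Qed.

Lemma fin_supp_fset (a : V) : fin a -> exists D : {fset G}, forall x, a x != 0 -> x \in D.
Proof. by move=> fa; have [D [aD _]] := fin_support fa fa; exists D. Qed.

Lemma wrun_bound i l K (g : G) (q : V) B : (K <= l)%N ->
  (forall D : {fset G}, \sum_(x <- D) nsq (q x) <= B) ->
  cbd (pair (wrun e i l (delta g)) q) (rho ^+ K * (1 + B) / 2).
Proof.
move=> Kl qB; have /andP[r0 r1] := rho_bounds.
have fa := fin_run fin_e star_e i l (fin_dirac R g).
have [D aD] := fin_supp_fset fa.
have nrm : \sum_(x <- D) nsq (wrun e i l (delta g) x) <= (rho ^+ K) ^+ 2.
  have := wrun_norm fin_e star_e idem_e i l g.
  rewrite (pair_self aD) (alphaE fin_e star_e idem_e) -rmorphXn => /complexI ->.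
  have a0 := ltW (alpha_gt0 fin_e star_e idem_e e_neq0).
  rewrite exprAC sqr_sqrtr//; apply: ler_wiXn2l => //.
  exact: ltW (alpha_lt1 fin_e star_e idem_e e_neq0 e_neq1).
rewrite (pairE _ aD); have rK : 0 < rho ^+ K by rewrite exprn_gt0.
(* The squared norm is at most [rho^(2 K)], so the weight [rho^K] leaves one factor [rho^K] in both
   terms. *)
apply: cbdW (cbd_sum_mul rK nrm (qB D)).
by rewrite expr2 mulfK ?lt0r_neq0// mulrDr mulr1.
Qed.

Lemma rest_bound K (g : G) (q : V) B : (forall D : {fset G}, \sum_(x <- D) nsq (q x) <= B) ->
  cbd (pair (rest e K (delta g)) q) (eta K * ((1 + B) / 2)).
Proof.
move=> qB; have fr i l := fin_run fin_e star_e i l (fin_dirac R g).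
rewrite /rest pairBl; [|by apply: fin_sum => b; exact: fr..].
rewrite !pair_suml => [|b|b]; [|exact: fr..].
have -> : eta K * ((1 + B) / 2) =
    (rho ^+ K * (1 + B) / 2) *+ size (index_enum 'I_K.+1) +
    (rho ^+ K * (1 + B) / 2) *+ size (index_enum 'I_K).
  have sz n : size (index_enum 'I_n) = n by rewrite [index_enum _]unlock -enumT size_enum_ord.
  by rewrite !sz -mulrnDr /eta -[RHS]mulr_natl !mulrA.
apply: cbdD; last apply: cbdN; apply: cbd_sum => b; exact: wrun_bound.
Qed.

Lemma fin_bound (a : V) : fin a -> exists M, forall D : {fset G}, \sum_(x <- D) nsq (a x) <= M.
Proof.
move=> fa; have [D aD] := fin_supp_fset fa.
exists (\sum_(x <- D) nsq (a x)) => D'.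
have n0 x : 0 <= nsq (a x) by exact: nsq_ge0.
apply: (le_trans (sum_fset_le n0 (fsubsetUl D' D))).
rewrite (big_fset_incl _ (fsubsetUr D' D))// => x _ xD.
have -> : a x = 0 by apply/eqP; apply: contraNT xD => /aD.
by rewrite /nsq expr0n addr0.
Qed.

Lemma sum_nsqD (f g : V) A B (D : {fset G}) :
  \sum_(x <- D) nsq (f x) <= A -> \sum_(x <- D) nsq (g x) <= B ->
  \sum_(x <- D) nsq (f x + g x) <= 2 * A + 2 * B.
Proof.
move=> fA gB; apply: (@le_trans _ _ (\sum_(x <- D) (2 * nsq (f x) + 2 * nsq (g x)))).
  by apply: ler_sum => x _; exact: nsqD2.
by rewrite big_split/= -!mulr_sumr lerD// ler_pM2l.
Qed.

(** The two summands [E 0 t] and [t^-1 E 0] are adjoint to each other. *)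
Lemma adj_wstep : adj T T.
Proof.
have aE := adj_E fin_e star_e 0.
have H := adjD (adj_comp aE (adj_t (U := U) (R := R))) (adj_comp (adj_t' (U := U) (R := R)) aE).
by move=> a q /(H a q)[fT ->]; split=> //; rewrite /wstep /step addrC.
Qed.

Section Projection.
Variables (mu : R) (g : G).
Local Notation p_ K := (partial e mu K (delta g)).

(* The difference [d] of two partial sums is itself an eigenvector, so that
   [<d, d> = <rest L - rest M, d>]: no orthogonality of the summands is needed. *)
Lemma partial_close eps L M : eps <= 1 -> eta L <= eps / 2 -> eta M <= eps / 2 ->
  forall D : {fset G}, \sum_(x <- D) nsq (p_ M x - p_ L x) <= eps.
Proof.
move=> e1 eL eM D; pose d : V := p_ M - p_ L.
have fd0 := fin_dirac R g.
have fp K : fin (p_ K) by exact: fin_partial.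
have fd : fin d by exact: finB.
have [D' dD] := fin_supp_fset fd.
pose D2 := (D `|` D')%fset.
have dD2 x : d x != 0 -> x \in D2 by move/dD => xD; rewrite inE xD orbT.
set N := \sum_(x <- D2) nsq (d x).
have N0 : 0 <= N by apply: sumr_ge0 => x _; exact: nsq_ge0.
have dN (D3 : {fset G}) : \sum_(x <- D3) nsq (d x) <= N.
  have n0 x : 0 <= nsq (d x) by exact: nsq_ge0.
  apply: (le_trans (sum_fset_le n0 (fsubsetUl D3 D2))).
  rewrite /N (big_fset_incl _ (fsubsetUr D3 D2))// => x _ xD.
  have -> : d x = 0 by apply/eqP; apply: contraNT xD => /dD2.
  by rewrite /nsq expr0n addr0.
apply: (le_trans (dN D)).
have ev : T d = mu%:C *: d by rewrite linearB/= !step_partial// -scalerBr.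
have eq : pair d d = pair (rest e L (delta g)) d - pair (rest e M (delta g)) d.
  by rewrite {1}/d pairBl// !pair_partial// opprB addrC addrA subrK.
have : cbd (pair d d) (eta L * ((1 + N) / 2) + eta M * ((1 + N) / 2)).
  by rewrite eq; apply: cbdD; [exact: rest_bound|apply: cbdN; exact: rest_bound].
move=> [+ _]; rewrite (pair_self dD2) /= ger0_norm// -/N => b.
(* The bound is [N <= eps (1 + N) / 2]; as [eps <= 1], the term [eps N / 2] is absorbed by half of
   [N], which leaves [N <= eps]. *)
have : (eta L + eta M) * (1 + N) <= eps * (1 + N).
  by rewrite ler_wpM2r//; lra.
have : eps * N <= N by rewrite -[leRHS]mul1r ler_wpM2r.
lra.
Qed.

(** Completeness of [l^2] for this one sequence: limits are taken pointwise, and the Cauchy bound is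
    uniform in the finite set [D]. *)
Lemma exists_limit : exists p : V,
  (forall eps, 0 < eps -> exists K0, forall K, (K0 <= K)%N ->
     forall D : {fset G}, \sum_(x <- D) nsq (p_ K x - p x) <= eps).
Proof.
have cau eps : 0 < eps -> exists K0, forall L M, (K0 <= L)%N -> (K0 <= M)%N ->
    forall D : {fset G}, \sum_(x <- D) nsq (p_ M x - p_ L x) <= eps.
  move=> e0; have d0 : 0 < Num.min eps 1 / 2 by rewrite divr_gt0// lt_min e0 ltr01.
  have [K0 H] := eta_small d0; exists K0 => L M /H hL /H hM D.
  have m1 : Num.min eps 1 <= 1 by rewrite ge_min lexx orbT.
  by rewrite (le_trans (partial_close m1 hL hM D))// ge_min lexx.
have /choice[p Hp] : forall x, exists l, forall eps, 0 < eps ->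
    exists N, forall n, (N <= n)%N -> nsq (p_ n x - l) <= eps.
  move=> x; apply: complex_cauchy => eps /cau[K0 H]; exists K0 => n Kn.
  by have := H K0 n (leqnn _) Kn [fset x]%fset; rewrite big_seq_fset1.
exists p => eps e0; have e4 : 0 < eps / 4 by rewrite divr_gt0.
have [K0 H] := cau _ e4; exists K0 => K KK D.
(* [M] may depend on [D]: it serves only as an intermediate index, and the final bound does not
   involve it. *)
have [M MK HM] : exists2 M, (K0 <= M)%N &
    \sum_(x <- D) nsq (p_ M x - p x) <= eps / 4.
  set w := eps / 4 / (size D).+1%:R; have w0 : 0 < w by rewrite divr_gt0.
  have [N HN] : exists N, forall n, (N <= n)%N -> forall x, x \in (D : seq G) ->
      nsq (p_ n x - p x) <= w.
    elim: (D : seq G) => [|x s [N HN]]; first by exists 0%N.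
    have [N' HN'] := Hp x _ w0; exists (maxn N N') => n.
    rewrite geq_max => /andP[Nn Nn'] y; rewrite inE => /orP[/eqP->|ys].
      exact: HN'.
    exact: HN.
  exists (maxn N K0); first exact: leq_maxr.
  rewrite big_seq; apply: (@le_trans _ _ (\sum_(x <- D | x \in D) w)).
    by apply: ler_sum => x xD; apply: HN => //; exact: leq_maxl.
  rewrite -big_seq big_const_seq count_predT iter_addr_0 -[leLHS]mulr_natr /w.
  by rewrite -[leLHS]mulrA ler_piMr ?(ltW e4)// mulrC ler_pdivrMr ?ltr0n// mul1r ler_nat.
have := @sum_nsqD (fun x => p_ K x - p_ M x) (fun x => p_ M x - p x) _ _ D (H M K MK KK D) HM.
have -> : 2 * (eps / 4) + 2 * (eps / 4) = eps by field.
by under eq_bigr do rewrite addrA subrK.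
Qed.

Lemma kernel_projection : exists p : V,
  [/\ exists M, forall D : {fset G}, \sum_(x <- D) nsq (p x) <= M,
      T p = mu%:C *: p,
      forall q, (exists M, forall D : {fset G}, \sum_(x <- D) nsq (q x) <= M) ->
        T q = mu%:C *: q -> inner (fun x => delta g x - p x) q = 0 &
      forall x eps, 0 < eps -> exists K0, forall K, (K0 <= K)%N -> nsq (p_ K x - p x) <= eps].
Proof.
have [p Hp] := exists_limit; exists p.
have fd0 := fin_dirac R g.
have fp K : fin (p_ K) by exact: fin_partial.
have [K1 HK1] := Hp 1 ltr01.
have near1 (D : {fset G}) : \sum_(x <- D) nsq (p x - p_ K1 x) <= 1.
  apply: le_trans (HK1 _ (leqnn _) D); apply: ler_sum => x _.
  by rewrite -opprB /nsq reN imN !sqrrN.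
split.
- have [M HM] := fin_bound (fp K1); exists (2 * 1 + 2 * M) => D.
  have := sum_nsqD (near1 D) (HM D).
  by under eq_bigr do rewrite subrK.
(* The eigenvalue equation at [x] is tested by the finitely supported [a], since self-adjointness
   turns [pair a f] into the conjugate of [(T - mu) f] at [x]. This passes to the limit, as only
   finitely many values of [p] enter. *)
- apply/funext => x; pose a : V := T (delta x) - mu%:C *: delta x.
  have fT : fin (T (delta x)) by have [] := adj_wstep (0 : V) (fin_dirac R x).
  have fa : fin a by apply: finB => //; apply/finZ/fin_dirac.
  have pa f : pair a f = conjc (T f x - mu%:C * f x).
    rewrite pairBl//; last exact/finZ/fin_dirac.
    have [_ ->] := adj_wstep f (fin_dirac R x).
    rewrite pairZl ?pair_dirac//; last exact: fin_dirac.
    rewrite (rmorphB (@conjc R)) (rmorphM (@conjc R)); congr (_ - _ * _).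
    exact/esym/conjc_real.
  suff : pair a p = 0.
    rewrite pa => /(congr1 (@conjc R)); rewrite conjcK conjc0 => /eqP.
    by rewrite subr_eq0 => /eqP.
  apply: cbd_eq0 => eps e0.
  have [D aD] := fin_supp_fset fa; have [A HA] := fin_bound fa.
  have A0 : 0 <= A by have := HA fset0; rewrite big_seq_fset0.
  (* With weight [r^-1] and approximation error [r^2], the product bound is
     [(A r + r) / 2 = eps / 2]. *)
  pose r := eps / (A + 1); have r0 : 0 < r by rewrite divr_gt0// ltr_wpDl.
  have [K HK] := Hp _ (exprn_gt0 2 r0).
  have z : pair a (p_ K) = 0.
    by rewrite pa step_partial// fctE subrr conjc0.
  have -> : pair a p = - pair a (p_ K - p).
    by rewrite pairDr// z add0r -(scaleN1r p) pairZr (rmorphN1 (@conjc R)) mulN1r opprK.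
  apply: cbdN; rewrite (pairE _ aD).
  have ri : 0 < r^-1 by rewrite invr_gt0.
  apply: cbdW (cbd_sum_mul ri (HA D) (HK _ (leqnn _) D)).
  rewrite invrK expr2 mulKf ?lt0r_neq0//.
  have -> : A * r + r = eps by rewrite /r; field; rewrite lt0r_neq0// ltr_wpDl.
  lra.
- move=> q [B HB] ev.
  have B0 : 0 <= B by have := HB fset0; rewrite big_seq_fset0.
  have [M HM] := fin_bound (finB fd0 (fp K1)).
  have bd (D : {fset G}) : \sum_(x <- D) nsq (delta g x - p x) <= 2 * M + 2 * 1.
    have := sum_nsqD (HM D) (HK1 _ (leqnn _) D).
    by under eq_bigr do rewrite fctE addrA subrK.
  apply: (inner_lim bd HB) => eps e0.
  (* Makes each of the two errors at most [eps / 2]: the distance from [p_ K] to [p], and the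
     pairing of [q] with the remainder, to which [pair_partial] reduces [delta g - p_ K]. *)
  pose r := eps / (B + 1); have r0 : 0 < r by rewrite divr_gt0// ltr_wpDl.
  have [K2 HK2] := eta_small r0; have [K3 HK3] := Hp _ (exprn_gt0 2 r0).
  pose K := maxn K2 K3.
  have fa : fin (delta g - p_ K) by exact: finB.
  have [D0 aD0] := fin_supp_fset fa; exists D0 => D DD; rewrite subr0.
  have -> : \sum_(x <- D) (delta g x - p x) * conjc (q x) =
      pair (delta g - p_ K) q + \sum_(x <- D) (p_ K x - p x) * conjc (q x).
    rewrite (@pairE _ _ D) => [|x /aD0 xD]; last exact: (fsubsetP DD).
    rewrite -big_split; apply: eq_bigr => x _.
    by rewrite /= -mulrDl fctE addrA subrK.
  rewrite pairBl// pair_partial// opprB addrC [X in _ + X]addrCA subrr addr0.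
  apply: cbdW (cbdD (cbd_sum_mul r0 (HK3 K (leq_maxr _ _) D) (HB D)) (rest_bound K g HB)).
  have b : eta K <= r by apply: HK2; exact: leq_maxl.
  have : eta K * ((1 + B) / 2) <= r * ((1 + B) / 2).
    by rewrite ler_wpM2r// divr_ge0// addr_ge0.
  rewrite expr2 mulfK ?lt0r_neq0//.
  have -> : r * ((1 + B) / 2) = eps / 2.
    by rewrite /r; field; rewrite lt0r_neq0// ltr_wpDl.
  have -> : r + r * B = eps by rewrite /r; field; rewrite lt0r_neq0// ltr_wpDl.
  lra.
- move=> x eps /Hp[K0 H]; exists K0 => K KK.
  by have := H K KK [fset x]%fset; rewrite big_seq_fset1.
Qed.

End Projection.
End Limit.

(** * The dimension formula and the completeness of the eigenspaces *)

Section Final.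
Variables (R : realType) (U : grp) (e : U -> R[i]).
Local Notation C := R[i].
Local Notation G := (wgrp U).
Local Notation V := (G -> C).
Hypothesis fin_e : @in_group_algebra R U e.
Hypothesis star_e : @gstar R U (@ginv U) e = e.
Hypothesis idem_e : forall u, @convU R U e e u = e u.
Hypothesis e_neq0 : e <> (fun _ => 0).
Hypothesis e_neq1 : e <> @dirac_fun R U (@gone U).
Local Notation delta := (@dirac_fun R G).
Local Notation fin a := (@in_group_algebra R G a).
Local Notation alpha := (alpha e).
Local Notation T := (wstep e).

Lemma kerTP (mu : R) (f : V) : kerT e mu f <->
  (exists M, forall D : {fset G}, \sum_(x <- D) nsq (f x) <= M) /\ T f = mu%:C *: f.
Proof.
split=> [[/l2_bound lf ev]|[[M /bound_l2 lf] ev]]; split=> //.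
  by apply/funext => x; apply/eqP; rewrite -subr_eq0 -(conv_wstep fin_e); apply/eqP/ev.
by move=> x; rewrite conv_wstep// ev subrr.
Qed.

(** The diagonal values of the partial sums already converge to that of the projection, so their
    limit may be found along arbitrarily large [K] of a convenient form. *)
Lemma kernel_dim (mu d : R) :
  (forall eps, 0 < eps -> forall K0, exists2 K, (K0 <= K)%N &
     `|\sum_(m < K | cheb mu m.+1 == 0) alpha ^+ m * (1 - alpha) ^+ 2 - d| <= eps) ->
  has_kernel_dim e mu d%:C.
Proof.
move=> Hd; have [p [bp ev orth lim]] :=
  kernel_projection fin_e star_e idem_e e_neq0 e_neq1 mu (gone : G).
exists p; split; first exact/kerTP; split=> [q /kerTP[bq evq]|]; first exact: orth.
have -> : inner p (delta gone) = p gone.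
  rewrite (@inner_fin R G p _ [fset gone]%fset) => [|x].
    by rewrite big_seq_fset1 /dirac_fun asboolT// conjc1 mulr1.
  by rewrite in_fset1 /dirac_fun => /eqP xg; rewrite asboolF// conjc0 mulr0.
apply/eqP; rewrite -subr_eq0; apply/eqP/nsq_eq0/eqP.
rewrite eq_le nsq_ge0 andbT; apply/ler_addgt0Pr => eps e0; rewrite add0r.
have e4 : 0 < eps / 4 by rewrite divr_gt0.
(* With [r <= 1], an error of at most [r] has square at most [r], hence at most [eps / 4]. *)
set r := Num.min 1 (eps / 4); have r0 : 0 < r by rewrite lt_min ltr01.
have [K0 H] := lim gone _ e4; have [K /H h1 h2] := Hd _ r0 K0.
set pK := partial e mu K (delta gone) gone in h1.
have h3 : nsq (pK - d%:C) <= eps / 4.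
  rewrite /pK partial_dirac// -rmorphB /nsq/= expr0n addr0 -real_normK ?num_real//.
  rewrite expr2; apply: (@le_trans _ _ (1 * r)); last by rewrite mul1r ge_min lexx orbT.
  by rewrite ler_pM// (le_trans h2)// ge_min lexx.
have := nsqD2 (- (pK - p gone)) (pK - d%:C).
rewrite opprB addrA subrK [nsq (p gone - pK)]/nsq.
have -> : p gone - pK = - (pK - p gone) by rewrite opprB.
by rewrite reN imN !sqrrN -/(nsq _); move: h1 h3; lra.
Qed.

(** For each path length, the eigenvectors of all eigenvalues of the path span its vertices by
    [cheb_indep], so [f] is orthogonal to every vertex component of [delta g]. What remains of [f g]
    is its pairing with the part of [delta g] on long paths, which is arbitrarily small. *)
Lemma orthogonal_eigenspaces (f : V) :
  (exists M, forall D : {fset G}, \sum_(x <- D) nsq (f x) <= M) ->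
  (forall (mu : R) (q : V), kerT e mu q -> inner f q = 0) -> f = (fun _ => 0).
Proof.
move=> [B fB] orth; apply/funext => g.
have fd := fin_dirac R g.
have vertex m b : (b <= m)%N -> pair (wblock e (- b%:Z) m (delta g)) f = 0.
  move=> bm.
  pose y i := pair (iter i (@tL R U) (wblock e 0 m (iter b (@tL' R U) (delta g)))) f.
  have fy i : fin (iter i (@tL R U) (wblock e 0 m (iter b (@tL' R U) (delta g)))).
    have A := adj_comp (adj_iter i (adj_t (U := U) (R := R))) (adj_comp (adj_block fin_e star_e 0 m)
      (adj_iter b (adj_t' (U := U) (R := R)))).
    by have [] := A _ f fd.
  have -> : pair (wblock e (- b%:Z) m (delta g)) f = y b by rewrite /y wblock_conj.
  apply: (@cheb_indep _ [seq x%:C | x <- lams R m.+1] m.+1 y) => //.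
  - by rewrite map_inj_uniq ?lams_uniq//; exact: complexI.
  - by rewrite size_map size_lams.
  move=> _ /mapP[x /cheb_lams root ->].
  have fp := fin_pathvec fin_e star_e x m b fd.
  have : kerT e x (pathvec e x m b (delta g)).
    apply/kerTP; split; last exact: step_pathvec.
    exact: fin_bound.
  move/orth; have [D pD] := fin_supp_fset fp.
  rewrite (@inner_fin R G f _ D) => [|z zD]; last first.
    have -> : pathvec e x m b (delta g) z = 0 by apply/eqP; apply: contraNT zD => /pD.
    by rewrite conjc0 mulr0.
  move/(congr1 (@conjc R)); rewrite conjc0 (rmorph_sum (@conjc R)) => H.
  have {H} : pair (pathvec e x m b (delta g)) f = 0.
    rewrite (pairE _ pD) -[RHS]H; apply: eq_bigr => z _.
    rewrite [RHS](rmorphM (@conjc R)) mulrC; congr (_ * _).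
    exact/esym/conjcK.
  rewrite /pathvec pair_suml => [H|i]; last exact: finZ.
  rewrite -[RHS]H; apply: eq_bigr => i _.
  by rewrite pairZl// cheb_complex mulrC.
suff : pair (delta g) f = 0.
  by rewrite pair_dirac => /(congr1 (@conjc R)); rewrite conjcK conjc0.
have rE K : pair (delta g) f = pair (rest e K (delta g)) f.
  apply/eqP; rewrite -subr_eq0 -pair_blocks//; apply/eqP/big1 => m _.
  by apply: big1 => b _; rewrite vertex// -ltnS.
apply: cbd_eq0 => eps e0.
have B0 : 0 <= B by have := fB fset0; rewrite big_seq_fset0.
have b0 : 0 < (1 + B) / 2 by rewrite divr_gt0// ltr_pwDl.
have [K H] := eta_small fin_e star_e idem_e e_neq0 e_neq1 (divr_gt0 e0 b0).
rewrite (rE K); apply: cbdW (rest_bound fin_e star_e idem_e e_neq0 e_neq1 K g fB).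
by rewrite -ler_pdivlMr// H.
Qed.

(** By [cheb_Mset] only the [m] with [m + 2 = k N] contribute, for [1 <= k <= (K + 1) / N]: a finite
    geometric series of ratio [alpha ^+ N], rewritten in terms of the inverse of [alpha]. *)
Lemma eigenvalue_sum (N : nat) (mu : R) K : (2 <= N)%N -> Mset N mu ->
  \sum_(m < K | cheb mu m.+1 == 0) alpha ^+ m * (1 - alpha) ^+ 2 =
  (alpha^-1 - 1) ^+ 2 / (alpha^-1 ^+ N - 1) * (1 - alpha ^+ (N * (K.+1 %/ N))).
Proof.
move=> N2 muN; have a0 := alpha_gt0 fin_e star_e idem_e e_neq0.
have a1 := alpha_lt1 fin_e star_e idem_e e_neq0 e_neq1.
have an0 : alpha != 0 by rewrite gt_eqF.
have N0 : (0 < N)%N by exact: ltnW.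
have aN : alpha ^+ N < 1 by rewrite exprn_ilt1 ?ltW// -lt0n.
elim: K => [|K IH]; first by rewrite big_ord0 divn_small// muln0 expr0 subrr mulr0.
rewrite big_mkcond big_ord_recr -big_mkcond IH /= (cheb_Mset _ N2 muN) [in RHS]divnS//.
case: ifP => [dv|_]; last by rewrite add0n addr0.
rewrite mulnDr muln1 exprD.
(* Here [N] divides [K + 2]; the factor [alpha ^- 2] is the shift between the index [K] of the new
   term and that multiple of [N]. *)
have E : alpha ^+ K = alpha ^+ N * alpha ^+ (N * (K.+1 %/ N)) * alpha ^- 2.
  have : (N * (K.+2 %/ N) = K.+2)%N by rewrite mulnC divnK.
  rewrite divnS// dv mulnDr muln1 -exprD => ->.
  by rewrite -addn2 exprD mulfK// expf_neq0.
rewrite E; set z := alpha ^+ (N * _); set w := alpha ^+ N in aN *.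
have w0 : w != 0 by rewrite expf_neq0.
rewrite exprVn -/w; field.
by rewrite w0 mulN1r subr_eq0 eq_sym (lt_eqF aN); exact: an0.
Qed.

End Final.

Theorem theorem1p1 (R : realType) (U : grp) (e : U -> R[i]) :
  has_torsion U ->
  @in_group_algebra R U e ->
  @gstar R U (@ginv U) e = e ->
  (forall u, @convU R U e e u = e u) ->
  e <> (fun _ => 0) ->
  e <> @dirac_fun R U (@gone U) ->
  let W := (e gone)^-1 in
  (forall (n : nat) (mu : R), (2 <= n)%N -> Mset n mu ->
     has_kernel_dim e mu ((W - 1) ^+ 2 / (W ^+ n - 1))) /\
  (forall mu : R, ~ (exists n : nat, (2 <= n)%N /\ Mset n mu) ->
     has_kernel_dim e mu 0) /\
  (forall f : wreath U -> R[i], l2 f ->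
     (forall (mu : R) (q : wreath U -> R[i]), kerT e mu q -> inner f q = 0) ->
     f = (fun _ => 0)).
Proof.
move=> _ fin_e star_e idem_e e0 e1 W.
have a0 := alpha_gt0 fin_e star_e idem_e e0.
have a1 := alpha_lt1 fin_e star_e idem_e e0 e1.
split; [|split].
- move=> n mu n2 muM.
  set D := (((alpha e)^-1 - 1) ^+ 2 / ((alpha e)^-1 ^+ n - 1)).
  have -> : (W - 1) ^+ 2 / (W ^+ n - 1) = D%:C.
    by rewrite /W alphaE// /D !(rmorphM, rmorphB, rmorphXn, fmorphV, rmorph1).
  apply: kernel_dim => // eps eps0 K0.
  have n0 : (0 < n)%N by exact: ltnW.
  have D0 : 0 < `|D| + 1 by rewrite ltr_wpDl.
  have a01 : 0 <= alpha e < 1 by rewrite ltW.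
  have [K1 HK1] := expr_small a01 (divr_gt0 eps0 D0).
  (* For a multiple of [n] the quotient of [K + 1] by [n] is exact up to the discarded remainder 1,
     which is below [n]. *)
  exists (n * maxn K0 K1)%N; first by rewrite (leq_trans (leq_maxl K0 K1))// leq_pmull.
  rewrite (eigenvalue_sum fin_e star_e idem_e e0 e1 _ n2 muM) -/D mulrBr mulr1.
  rewrite addrAC subrr add0r normrN normrM.
  have -> : ((n * maxn K0 K1).+1 %/ n = maxn K0 K1)%N.
    by rewrite -addn1 mulnC divnMDl// divn_small// addn0.
  rewrite (ger0_norm (exprn_ge0 _ (ltW a0))).
  have : alpha e ^+ (n * maxn K0 K1) <= eps / (`|D| + 1).
    by apply: HK1; rewrite (leq_trans (leq_maxr K0 K1))// leq_pmull.
  rewrite ler_pdivlMr// => le; apply: le_trans le.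
  by rewrite mulrC ler_wpM2l ?lerDl// exprn_ge0// ltW.
- move=> mu nM; rewrite -[0](rmorph0 (real_complex R)).
  apply: kernel_dim => // eps eps0 K0; exists K0 => //.
  rewrite big_pred0 => [|m]; first by rewrite subr0 normr0 ltW.
  by rewrite (negbTE (cheb_nMset _ nM)).
- by move=> f /l2_bound bf; exact: orthogonal_eigenspaces.
Qed.
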